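(* Let $M=(m_{ij})_{1\le i,j\le l}$ be the Cartan matrix of $\mathfrak{g}$. The following system of $q$-difference equations holds for $i=1,\dots,l$: $$\chi_{W(\Lambda_0)}(x_1,\dots,x_l;q)=\chi_{W(\Lambda_0)}(x_1,\dots,x_iq,\dots,x_l;q)+(x_iq)\,\chi_{W(\Lambda_0)}(x_1q^{m_{i1}},\dots,x_lq^{m_{il}};q).$$
   Context: Let $\mathfrak{g}$ be a finite-dimensional complex simple Lie algebra of type $A$, $D$ or $E$ of rank $l$, with Cartan subalgebra $\mathfrak{h}$, simple roots $\alpha_1,\dots,\alpha_l$, set of roots $\Delta$, set of positive roots $\Delta_+$, and invariant form $\langle\cdot,\cdot\rangle$ normalized so that $\langle\alpha,\alpha\rangle=2$ for $\alpha\in\Delta$; identify $\mathfrak{h}$ with $\mathfrak{h}^*$ via this form. Let $\lambda_1,\dots,\lambda_l$ be the fundamental weights ($\langle\lambda_i,\alpha_j\rangle=\delta_{ij}$), and $Q=\sum_i\mathbb{Z}\alpha_i$ the root lattice. For each root $\alpha$ let $x_\alpha$ be a root vector (normalized below). Let $\widehat{\mathfrak{g}}=\mathfrak{g}\otimes\mathbb{C}[t,t^{-1}]\oplus\mathbb{C}\mathbf{k}$, $\mathbf{k}$ central, $[x\otimes t^m,y\otimes t^n]=[x,y]\otimes t^{m+n}+m\langle x,y\rangle\delta_{m+n,0}\mathbf{k}$. Let $\mathfrak{n}=\coprod_{\alpha\in\Delta_+}\mathbb{C}x_\alpha$ and $\bar{\mathfrak{n}}=\mathfrak{n}\otimes\mathbb{C}[t,t^{-1}]$.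 The basic (level one standard) $\widehat{\mathfrak{g}}$-module $L(\Lambda_0)$, i.e. the irreducible $\widehat{\mathfrak{g}}$-module of level one generated by a highest weight vector $v_{\Lambda_0}$ annihilated by $\mathfrak{g}\otimes\mathbb{C}[t]$, is realized as $V_Q=M(1)\otimes\mathbb{C}[Q]$ with $v_{\Lambda_0}=1\otimes e^0$. Here $M(1)=S(\mathfrak{h}\otimes t^{-1}\mathbb{C}[t^{-1}])$ is the level one Fock module for $\widehat{\mathfrak{h}}=\mathfrak{h}\otimes\mathbb{C}[t,t^{-1}]\oplus\mathbb{C}\mathbf{k}$ on which $\mathfrak{h}\otimes\mathbb{C}[t]$ annihilates the vacuum, and $\mathbb{C}[Q]$ has basis $e^\beta$, $\beta\in Q$. Fix a 2-cocycle $\epsilon:Q\times Q\to\mathbb{C}^\times$ with values in the roots of unity of a fixed finite order, $\epsilon(\alpha,0)=\epsilon(0,\alpha)=1$, and $\epsilon(\alpha,\beta)/\epsilon(\beta,\alpha)=(-1)^{\langle\alpha,\beta\rangle}$. For $h\in\mathfrak{h}$, $h(n)$ ($n\ne0$) acts on the factor $M(1)$ and $h(0)(v\otimes e^\beta)=\langle h,\beta\rangle v\otimes e^\beta$. For $\alpha\in\Delta$, the operators $x_\alpha(m)$ are given by $$\sum_{m\in\mathbb{Z}}x_\alpha(m)x^{-m-1}=\exp\left(\sum_{n<0}\frac{-\alpha(n)}{n}x^{-n}\right)\exp\left(\sum_{n>0}\frac{-\alpha(n)}{n}x^{-n}\right)e_\alpha x^\alpha,$$ where $e_\alpha(v\otimes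 e^\beta)=\epsilon(\alpha,\beta)v\otimes e^{\alpha+\beta}$ and $x^\alpha(v\otimes e^\beta)=x^{\langle\alpha,\beta\rangle}v\otimes e^\beta$. The root vectors $x_\alpha\in\mathfrak{g}$ are normalized so that $x_\alpha\otimes t^m$ acts as $x_\alpha(m)$. The principal subspace of $L(\Lambda_0)$ is $W(\Lambda_0)=U(\bar{\mathfrak{n}})\cdot v_{\Lambda_0}$. Gradings. The Virasoro operator $L(0)$ acts on $h_1(-n_1)\cdots h_k(-n_k)\otimes e^\beta$ ($h_j\in\mathfrak{h}$, $n_j\ge1$) as the scalar $n_1+\cdots+n_k+\frac12\langle\beta,\beta\rangle$, and $\lambda_j=\lambda_j(0)$ acts on it as the scalar $\langle\lambda_j,\beta\rangle$; these operators preserve $W(\Lambda_0)$. With commuting formal variables $x_1,\dots,x_l,q$, define $$\chi_{W(\Lambda_0)}(x_1,\dots,x_l;q)=\mathrm{tr}_{W(\Lambda_0)}\,x_1^{\lambda_1}\cdots x_l^{\lambda_l}q^{L(0)}\in\mathbb{C}[[x_1,\dots,x_l,q]].$$ In the first term on the right-hand side of the equations only the variable $x_i$ is replaced, by $x_iq$. *)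

(* Defs.v *)
From HB Require Import structures.
From mathcomp Require Import all_boot all_order all_algebra all_fingroup.
From mathcomp Require Import finmap.
From mathcomp Require Import boolp classical_sets functions cardinality fsbigop reals.
From mathcomp Require Import complex.
From mathcomp Require Import monalg.

Set Implicit Arguments.
Unset Strict Implicit.
Unset Printing Implicit Defensive.

Import GRing.Theory Num.Theory.
Local Open Scope classical_set_scope.
Local Open Scope ring_scope.

Definition chain_edge (i j : nat) : bool := (i.+1 == j)%N || (j.+1 == i)%N.

(* The nodes 0, ..., l-2 form a chain and the node l-1 is joined to b only. *)
Definition branch_edge (l b i j : nat) : bool :=
  [|| [&& (i < l.-1)%N, (j < l.-1)%N & chain_edge i j],
      (i == b) && (j == l.-1) | (j == b) && (i == l.-1)].

Definition graph_cartan (l : nat) (e : nat -> nat -> bool) : 'M[int]_l :=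
  \matrix_(i, j) (if i == j then 2 else if e i j then -1 else 0).

(* The permutation s accounts for the arbitrary numbering of simple roots. *)
Definition type_ADE (l : nat) (M : 'M[int]_l) : Prop :=
  exists s : 'S_l, let N := row_perm s (col_perm s M) in
  [\/ (1 <= l)%N /\ N = graph_cartan l chain_edge,
      (4 <= l)%N /\ N = graph_cartan l (branch_edge l (l - 3)) |
      (6 <= l <= 8)%N /\ N = graph_cartan l (branch_edge l 2)].

Section LieAlgebra.
Variables (K : fieldType) (g : vectType K).
Variables (br : g -> g -> g) (form : g -> g -> K).

Record lie_bracket : Prop := LieBracket {
  lie_linearl : forall y, linear (br ^~ y);
  lie_linearr : forall x, linear (br x);
  lie_alt : forall x, br x x = 0;
  lie_jacobi : forall x y z, br x (br y z) + br y (br z x) + br z (br x y) = 0 }.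

Record simple_lie_algebra : Prop := SimpleLieAlgebra {
  simple_lie : lie_bracket;
  simple_nonabelian : exists x y, br x y != 0;
  simple_ideal : forall I : {vspace g},
    (forall x y, y \in I -> br x y \in I) -> I = 0%VS \/ I = fullv }.

Definition ad_semisimple (x : g) : Prop :=
  exists b : seq g,
    basis_of fullv b /\ forall v, v \in b -> exists c, br x v = c *: v.

(* For semisimple complex Lie algebras: a toral subalgebra that is its own
   centralizer. *)
Record cartan_subalgebra (H : {vspace g}) : Prop := CartanSubalgebra {
  cartan_abelian : forall x y, x \in H -> y \in H -> br x y = 0;
  cartan_ss : forall x, x \in H -> ad_semisimple x;
  cartan_centralizer : forall x, (forall h, h \in H -> br h x = 0) -> x \in H }.

Record invariant_form : Prop := InvariantForm {
  form_linearl : forall y, scalar (form ^~ y);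
  form_sym : forall x y, form x y = form y x;
  form_invariant : forall x y z, form (br x y) z = form x (br y z) }.

(* H and its dual being identified by the form, roots are elements of H. *)
Definition root_vector (H : {vspace g}) (a x : g) : Prop :=
  x != 0 /\ forall h, h \in H -> br h x = form a h *: x.

Definition is_root (H : {vspace g}) (a : g) : Prop :=
  [/\ a \in H, a != 0 & exists x, root_vector H a x].

Definition normalized_form (H : {vspace g}) : Prop :=
  invariant_form /\ forall a, is_root H a -> form a a = 2.

Variables (l : nat) (alpha : 'I_l -> g).

(* The root lattice Q is 'rV[int]_l, in coordinates w.r.t. simple roots. *)
Definition of_lattice (b : 'rV[int]_l) : g := \sum_i (b 0 i)%:~R *: alpha i.

Record simple_roots (H : {vspace g}) : Prop := SimpleRoots {
  simple_is_root : forall i, is_root H (alpha i);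
  simple_basis : basis_of H [seq alpha i | i <- enum 'I_l];
  simple_sign : forall a, is_root H a -> exists2 b : 'rV[int]_l,
    a = of_lattice b & (forall i, 0 <= b 0 i) \/ (forall i, b 0 i <= 0) }.

Definition cartan_matrix (M : 'M[int]_l) : Prop :=
  forall i j, (M i j)%:~R =
    2 * form (alpha i) (alpha j) / form (alpha i) (alpha i).

Definition fundamental_weights (H : {vspace g}) (lam : 'I_l -> g) : Prop :=
  forall i, lam i \in H /\ forall j, form (lam i) (alpha j) = (i == j)%:R.

Definition positive_root (H : {vspace g}) (b : 'rV[int]_l) : Prop :=
  is_root H (of_lattice b) /\ forall i, 0 <= b 0 i.

End LieAlgebra.

Section LatticeSpace.
Variables (K : fieldType) (l : nat).

Definition lattice_form (M : 'M[int]_l) (a b : 'rV[int]_l) : int :=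
  (a *m M *m b^T) 0 0.

(* The cocycle takes values in the s-th roots of unity. *)
Record cocycle (M : 'M[int]_l) (s : nat) (eps : 'rV[int]_l -> 'rV[int]_l -> K)
    : Prop := Cocycle {
  cocycle_unity : (0 < s)%N /\ forall a b, eps a b ^+ s = 1;
  cocycle_id : forall a b c,
    eps a b * eps (a + b) c = eps b c * eps a (b + c);
  cocycle_normal : forall a, eps a 0 = 1 /\ eps 0 a = 1;
  cocycle_comm : forall a b, eps a b / eps b a = (-1) ^ lattice_form M a b }.

(* M(1) is the polynomial algebra in the alpha_j(-k-1), the variable indexed
   by (j, k) : 'I_l * nat; V_Q has basis the pairs (u, b), standing for the
   vector u (x) e^b with u a monomial of M(1) and b in Q. *)
Definition VQbasis : choiceType := ({cmonom ('I_l * nat)} * 'rV[int]_l)%type.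

Definition VQ : lmodType K := {malg K[VQbasis]}.

Definition VQvec (u : VQbasis) : VQ := << u >>.

Definition vacuum : VQ := VQvec (onecm _, 0 : 'rV[int]_l).

Definition lin_ext (F : VQbasis -> VQ) (v : VQ) : VQ :=
  \sum_(u <- msupp v) v@_u *: F u.

Variable M : 'M[int]_l.

(* alpha_i(n): multiplication by a variable for n < 0, the derivation with
   alpha_j(-k) |-> k delta_(k,n) <alpha_i, alpha_j> for n > 0. *)
Definition heis_basis (i : 'I_l) (n : int) (u : VQbasis) : VQ :=
  match n with
  | Negz k => VQvec (mulcm u.1 (ucm (i, k)), u.2)
  | Posz 0 => (lattice_form M (delta_mx 0 i) u.2)%:~R *: VQvec u
  | Posz k.+1 => \sum_j ((k.+1)%:R * (M i j)%:~R * (u.1 (j, k))%:R) *: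
                   VQvec (divcm u.1 (ucm (j, k)), u.2)
  end.

Definition heis (i : 'I_l) (n : int) : VQ -> VQ := lin_ext (heis_basis i n).

Definition lattice_heis (a : 'rV[int]_l) (n : int) (v : VQ) : VQ :=
  \sum_i (a 0 i)%:~R *: heis i n v.

(* The coefficient of x^r in exp (\sum_(n >= 1) A n x^n); the k-fold products
   with k > r do not contribute. *)
Definition exp_coef (A : nat -> VQ -> VQ) (r : nat) (v : VQ) : VQ :=
  \sum_(k < r.+1) (k`!%:R)^-1 *:
    \sum_(n : k.-tuple 'I_r.+1 |
            all (fun j : 'I_r.+1 => (0 < j)%N) n && (\sum_(j <- n) j == r)%N)
      foldr (fun (j : 'I_r.+1) w => A j w) v n.

(* x_a(m), the coefficient of x^(-m-1) in the vertex operator: r is the power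
   of x from the first exponential, s that of x^-1 from the second, and
   <a, b> comes from x^a. Only finitely many terms are nonzero. *)
Definition vertex_mode (eps : 'rV[int]_l -> 'rV[int]_l -> K)
    (a : 'rV[int]_l) (m : int) : VQ -> VQ :=
  lin_ext (fun u =>
    eps a u.2 *:
    \sum_(rs \in [set rs : nat * nat |
            rs.1%:Z - rs.2%:Z + lattice_form M a u.2 = - m - 1])
      exp_coef (fun n w => n%:R^-1 *: lattice_heis a (- n%:Z) w) rs.1
        (exp_coef (fun n w => - n%:R^-1 *: lattice_heis a n%:Z w) rs.2
           (VQvec (u.1, a + u.2)))).

Definition L0 : VQ -> VQ :=
  lin_ext (fun u =>
    (\sum_(x <- finsupp (cmonom_val u.1)) (u.1 x * x.2.+1)%:R
       + (lattice_form M u.2 u.2)%:~R / 2) *: VQvec u).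

End LatticeSpace.

Section Principal.
Variables (K : fieldType) (l : nat) (g : vectType K).
Variables (br : g -> g -> g) (form : g -> g -> K) (H : {vspace g}).
Variables (alpha : 'I_l -> g) (M : 'M[int]_l).

(* rho y m is the action of y (x) t^m, and k acts as the identity; xr b is the
   normalized root vector for b a root in Q (irrelevant for other b). *)
Record VQ_module (eps : 'rV[int]_l -> 'rV[int]_l -> K) (xr : 'rV[int]_l -> g)
    (rho : g -> int -> VQ K l -> VQ K l) : Prop := VQModule {
  rho_linear : forall y m, linear (rho y m);
  rho_linear_arg : forall m v, linear (fun y => rho y m v);
  rho_bracket : forall y z m n v,
    rho y m (rho z n v) - rho z n (rho y m v) =
      rho (br y z) (m + n) v
        + (if m + n == 0 then m%:~R * form y z else 0) *: v;
  rho_heis : forall i m v, rho (alpha i) m v = heis M i m v;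
  rho_root_vector : forall b, is_root br form H (of_lattice alpha b) ->
    root_vector br form H (of_lattice alpha b) (xr b);
  rho_vertex : forall b m v, is_root br form H (of_lattice alpha b) ->
    rho (xr b) m v = vertex_mode M eps b m v }.

Definition lin_span (V : lmodType K) (S : set V) : set V :=
  [set v | exists n (c : 'I_n -> K) (w : 'I_n -> V),
     (forall i, S (w i)) /\ v = \sum_i c i *: w i].

Definition nilradical (xr : 'rV[int]_l -> g) : set g :=
  lin_span [set xr b | b in positive_root br form alpha H].

(* U(n (x) C[t,t^-1]) . vacuum: U is spanned by the products of the y (x) t^m *)
Definition principal_subspace (xr : 'rV[int]_l -> g)
    (rho : g -> int -> VQ K l -> VQ K l) : set (VQ K l) :=
  lin_span [set v | exists2 s : seq (g * int),
     (forall ym, ym \in s -> nilradical xr ym.1) &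
     v = foldr (fun ym w => rho ym.1 ym.2 w) (vacuum K l) s].

End Principal.

Section Character.
Variables (K : fieldType) (l : nat).

Definition has_dim (V : lmodType K) (S : set V) (d : nat) : Prop :=
  exists b : 'I_d -> V,
    [/\ forall i, S (b i),
        forall c : 'I_d -> K, \sum_i c i *: b i = 0 -> forall i, c i = 0 &
        forall v, S v -> exists c : 'I_d -> K, v = \sum_i c i *: b i].

(* 0 if S is not a finite-dimensional subspace *)
Definition dimension (V : lmodType K) (S : set V) : nat :=
  xget 0%N [set d | has_dim S d].

(* f (n, d) is the coefficient of x_1^(n_1) ... x_l^(n_l) q^d; all integer
   exponents are allowed, so that x_j |-> x_j q^-1 is always meaningful. *)
Definition series : Type := 'rV[int]_l * int -> K.

(* x_j |-> x_j q^(a_j) for all j *)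
Definition qshift (a : 'rV[int]_l) (f : series) : series :=
  fun nd => f (nd.1, nd.2 - \sum_j a 0 j * nd.1 0 j).

(* multiplication by the monomial of exponent e *)
Definition monomial_mul (e : 'rV[int]_l * int) (f : series) : series :=
  fun nd => f (nd - e).

Definition weight_space (g : vectType K) (M : 'M[int]_l) (lam : 'I_l -> g)
    (rho : g -> int -> VQ K l -> VQ K l) (W : set (VQ K l))
    (nd : 'rV[int]_l * int) : set (VQ K l) :=
  [set w | [/\ W w, forall j, rho (lam j) 0 w = (nd.1 0 j)%:~R *: w &
               L0 M w = nd.2%:~R *: w]].

(* The trace of x_1^(lambda_1) ... x_l^(lambda_l) q^L(0): the operators are
   simultaneously diagonalizable, so each coefficient is a graded dimension. *)
Definition character (g : vectType K) (M : 'M[int]_l) (lam : 'I_l -> g)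
    (rho : g -> int -> VQ K l -> VQ K l) (W : set (VQ K l)) : series :=
  fun nd => (dimension (weight_space M lam rho W nd))%:R.

End Character.

(* Main.v *)
(** Write h_i(x) = \sum_r h_(i,r) x^r = exp (\sum_(k >= 1) alpha_i(-k) x^k / k).
    The h_(i,r), r >= 1, freely generate the algebra M(1), and W(Lambda_0) has as
    a basis the vectors m (x) e^b, where b has nonnegative coordinates b_i and m
    is a monomial in the h_(i,r) of degree at most b_i in the h_(i,.) for each i.
    Indeed, for a positive root a = \sum a_i alpha_i, the first exponential of
    Y(e^a, x) is \prod_i h_i(x)^(a_i), of degree a_i in the h_(i,.), and the
    second one is built from derivations mapping h_(i,r) to multiples of
    h_(i,r-k), which do not raise degrees; so these vectors span a subspace
    stable under n (x) C[t, t^-1].  Conversely they are reached from the vacuum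
    with the simple root vectors alone, by induction on b and on the weight.

    The coefficient of x^b q^d is therefore the number of l-coloured partitions
    of d - <b,b>/2 with at most b_i parts of colour i.  Those with fewer than b_i
    parts of colour i give the term in e_(alpha_i) W(Lambda_0), the others the
    term x_i |-> x_i q, by subtracting 1 from each of their parts of colour i. *)

Require Import Defs.
From HB Require Import structures.
From mathcomp Require Import all_boot all_order all_algebra all_fingroup.
From mathcomp Require Import finmap.
From mathcomp Require Import boolp classical_sets functions cardinality fsbigop reals.
From mathcomp Require Import complex.
From mathcomp Require Import monalg.
From mathcomp Require Import zify.

Set Implicit Arguments.
Unset Strict Implicit.
Unset Printing Implicit Defensive.

Import Order.TTheory GRing.Theory Num.Theory.
Local Open Scope classical_set_scope.
Local Open Scope ring_scope.

(** * Linear maps out of a free module *)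

Section FreeModule.
Variables (B : choiceType) (K : fieldType) (V : lmodType K).
Implicit Types (p : {malg K[B]}) (u : B).

Definition mlin (F : B -> V) p : V := \sum_(u <- msupp p) p@_u *: F u.

Lemma mlinEw (F : B -> V) p (d : {fset B}) : (msupp p `<=` d)%fset ->
  mlin F p = \sum_(u <- d) p@_u *: F u.
Proof.
move=> le; rewrite /mlin (big_fset_incl _ le) // => u _ /mcoeff_outdom ->.
by rewrite scale0r.
Qed.

Lemma mlin_is_linear (F : B -> V) : linear (mlin F).
Proof.
move=> c p q; pose d := (msupp p `|` msupp q)%fset.
have le_p : (msupp p `<=` d)%fset by apply: fsubsetUl.
have le_q : (msupp q `<=` d)%fset by apply: fsubsetUr.
have le : (msupp (c *: p + q) `<=` d)%fset.
  by rewrite (fsubset_trans (msuppD_le _ _)) // fsetSU // msuppZ_le.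
rewrite (mlinEw F le) (mlinEw F le_p) (mlinEw F le_q) scaler_sumr -big_split /=.
by apply: eq_bigr => u _; rewrite mcoeffD mcoeffZ scalerDl scalerA.
Qed.

HB.instance Definition _ (F : B -> V) :=
  GRing.isLinear.Build K {malg K[B]} V *:%R (mlin F) (mlin_is_linear F).

Lemma mlinU (F : B -> V) u : mlin F << u >> = F u.
Proof. by rewrite /mlin msuppU oner_eq0 big_seq_fset1 mcoeffUU scale1r. Qed.

Lemma malg_sum p : p = \sum_(u <- msupp p) p@_u *: << u >>.
Proof.
rewrite [LHS]monalgE; apply: eq_bigr => u _; apply/malgP => v.
by rewrite mcoeffZ !mcoeffU; case: eqP => _; rewrite ?mulr1 ?mulr0.
Qed.

Lemma eq_linear_malg (f g : {malg K[B]} -> V) : linear f -> linear g ->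
  (forall u, f << u >> = g << u >>) -> f =1 g.
Proof.
move=> lf lg eq_fg p.
(* The bare hypotheses [linear f] and [linear g] are packed into bundled linear maps, so that
   [linear_sum] and [linearZ] apply. *)
pose f' := HB.pack_for {linear {malg K[B]} -> V} f
  (GRing.isLinear.Build K {malg K[B]} V *:%R f lf).
pose g' := HB.pack_for {linear {malg K[B]} -> V} g
  (GRing.isLinear.Build K {malg K[B]} V *:%R g lg).
rewrite -[f]/(f' : _ -> _) -[g]/(g' : _ -> _) (malg_sum p) !linear_sum.
by apply: eq_bigr => u _; rewrite !linearZ /= eq_fg.
Qed.

End FreeModule.

(** * Commutative monomials and their weighted degrees *)

Section Monomials.
Variable I : choiceType.
Implicit Types (m : {cmonom I}) (x : I) (f : I -> nat).

Lemma cmonom_factor m x : (0 < m x)%N -> m = mulcm (ucm x) (divcm m (ucm x)).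
Proof.
move=> mx; apply/eqP/cmP => y; rewrite mulcmE divcmE ucmE.
by case: eqP => [<-|]; lia.
Qed.

Lemma cmonom_ind (Pr : {cmonom I} -> Prop) : Pr (onecm I) ->
  (forall x m, Pr m -> Pr (mulcm (ucm x) m)) -> forall m, Pr m.
Proof.
move=> P1 PU m; move: {2}(mdeg m) (erefl (mdeg m)) => n.
elim: n m => [|n IHn] m; first by move/mdeg_eq0I ->.
case: (fset_0Vmem (finsupp m)) => [m0|[x xm]].
  by rewrite mdegE m0 big_seq_fset0.
rewrite (@cmonom_factor m x) ?lt0n ?cmE_neq0 //.
by rewrite mdegM mdegU => -[/IHn]; apply: PU.
Qed.

(** One additive function covers the conformal weight (f the size of a part), the degree in one
    colour and a single exponent (f an indicator function). *)
Definition wdeg f m : nat := (\sum_(x <- finsupp m) m x * f x)%N.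

Lemma wdegEw f m (d : {fset I}) : (finsupp m `<=` d)%fset ->
  wdeg f m = (\sum_(x <- d) m x * f x)%N.
Proof.
move=> le; rewrite /wdeg (big_fset_incl _ le) // => x _ /=.
by rewrite -cmE_eq0 => /eqP ->.
Qed.

Lemma wdeg1 f : wdeg f (onecm I) = 0%N.
Proof. by rewrite /wdeg mdom1 big_seq_fset0. Qed.

Lemma wdegU f x : wdeg f (ucm x) = f x.
Proof. by rewrite /wdeg mdomU big_seq_fset1 cmUU mul1n. Qed.

Lemma wdegM f m1 m2 : wdeg f (mulcm m1 m2) = (wdeg f m1 + wdeg f m2)%N.
Proof.
rewrite {1}/wdeg mdomD (wdegEw f (fsubsetUl _ (finsupp m2))).
rewrite (wdegEw f (fsubsetUr (finsupp m1) _)) -big_split /=.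
by apply: eq_bigr => x _; rewrite mulcmE mulnDl.
Qed.

Lemma wdeg_delta m x : wdeg (fun y => (y == x) : nat) m = m x.
Proof.
elim/cmonom_ind: m => [|y m IHm]; first by rewrite wdeg1 onecmE.
by rewrite wdegM wdegU mulcmE ucmE IHm.
Qed.

Lemma wdeg_gt0 f m :
  (0 < wdeg f m)%N -> exists2 x, (0 < m x)%N & (0 < f x)%N.
Proof.
elim/cmonom_ind: m => [|x m IHm]; first by rewrite wdeg1.
rewrite wdegM wdegU addn_gt0 => /orP[fx|/IHm[y my fy]].
  by exists x => //; rewrite mulcmE ucmE eqxx.
by exists y => //; rewrite mulcmE addn_gt0 my orbT.
Qed.

End Monomials.


(* The polynomial algebra is packaged behind an opaque proof (malg_package):
   otherwise unification unfolds its operations and diverges. *)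
Record poly_package (I : choiceType) (K : fieldType) := PolyPackage {
  pkg_alg : comAlgType K;
  pkg_mono : {cmonom I} -> pkg_alg;
  pkg_mono1 : pkg_mono (onecm I) = 1;
  pkg_monoM : forall m1 m2,
    pkg_mono (mulcm m1 m2) = pkg_mono m1 * pkg_mono m2;
  pkg_eq_linear : forall (V : lmodType K) (f g : pkg_alg -> V),
    linear f -> linear g -> (forall m, f (pkg_mono m) = g (pkg_mono m)) ->
    f =1 g;
  pkg_ind : forall S : pkg_alg -> Prop, S 0 ->
    (forall c m p, S p -> S (c *: pkg_mono m + p)) -> forall p, S p;
  pkg_lin : forall V : lmodType K, ({cmonom I} -> V) -> pkg_alg -> V;
  pkg_lin_is_linear : forall V F, linear (@pkg_lin V F);
  pkg_linE : forall V F m, @pkg_lin V F (pkg_mono m) = F m }.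

Lemma malg_package (I : choiceType) (K : fieldType) : poly_package I K.
Proof.
apply: (@PolyPackage _ _ {malg K[{cmonom I}]} (fun m => << m >>) _ _ _ _
  (fun V F => mlin F)) => //.
- by move=> m1 m2; rewrite [RHS]malgM_def fgmulUU mulr1.
- by move=> V f g; apply: eq_linear_malg.
- move=> S S0 SD p; rewrite (malg_sum p).
  by elim: (X in \sum_(u <- X) _) => [|m s IHs]; rewrite ?big_nil ?big_cons //; apply: SD.
- by move=> V F; apply: mlin_is_linear.
- by move=> V F m; apply: mlinU.
Qed.

(** * Evaluation morphisms on the polynomial algebra *)

Section Evaluation.
Variables (I : choiceType) (K : fieldType).
Implicit Types (m : {cmonom I}).

Definition polyalg : comAlgType K := pkg_alg (malg_package I K).

Definition mono m : polyalg := pkg_mono _ m.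

Lemma mono1 : mono (onecm I) = 1.
Proof. exact: pkg_mono1. Qed.

Lemma monoM m1 m2 : mono (mulcm m1 m2) = mono m1 * mono m2.
Proof. exact: pkg_monoM. Qed.

Lemma eq_linear_poly (V : lmodType K) (f g : polyalg -> V) :
  linear f -> linear g -> (forall m, f (mono m) = g (mono m)) -> f =1 g.
Proof. exact: pkg_eq_linear. Qed.

Lemma poly_ind (S : polyalg -> Prop) : S 0 ->
  (forall c m p, S p -> S (c *: mono m + p)) -> forall p, S p.
Proof. exact: pkg_ind. Qed.

Definition plin (V : lmodType K) (F : {cmonom I} -> V) : polyalg -> V :=
  pkg_lin F.

Lemma plin_is_linear (V : lmodType K) (F : {cmonom I} -> V) : linear (plin F).
Proof. exact: pkg_lin_is_linear. Qed.

HB.instance Definition _ (V : lmodType K) (F : {cmonom I} -> V) :=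
  GRing.isLinear.Build K polyalg V *:%R (plin F) (plin_is_linear F).

Lemma plinE (V : lmodType K) (F : {cmonom I} -> V) m : plin F (mono m) = F m.
Proof. exact: pkg_linE. Qed.

Variable A : comAlgType K.
Implicit Types (h : I -> A).

Definition monom_eval h m : A := \prod_(x <- finsupp m) h x ^+ m x.

Lemma monom_evalEw h m (d : {fset I}) : (finsupp m `<=` d)%fset ->
  monom_eval h m = \prod_(x <- d) h x ^+ m x.
Proof.
move=> le; rewrite /monom_eval (big_fset_incl _ le) // => x _.
by rewrite -cmE_eq0 => /eqP ->.
Qed.

Lemma monom_evalM h m1 m2 :
  monom_eval h (mulcm m1 m2) = monom_eval h m1 * monom_eval h m2.
Proof.
rewrite {1}/monom_eval mdomD (monom_evalEw h (fsubsetUl _ (finsupp m2))).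
rewrite (monom_evalEw h (fsubsetUr (finsupp m1) _)) -big_split /=.
by apply: eq_bigr => x _; rewrite mulcmE exprD.
Qed.

Definition meval h : polyalg -> A := plin (monom_eval h).

HB.instance Definition _ h := GRing.Linear.on (meval h).

Lemma mevalE h m : meval h (mono m) = monom_eval h m.
Proof. exact: plinE. Qed.

Lemma mevalX h x : meval h (mono (ucm x)) = h x.
Proof. by rewrite mevalE /monom_eval mdomU big_seq_fset1 cmUU expr1. Qed.

Lemma meval1 h : meval h 1 = 1.
Proof. by rewrite -mono1 mevalE /monom_eval mdom1 big_seq_fset0. Qed.

Lemma mevalM h p q : meval h (p * q) = meval h p * meval h q.
Proof.
move: p; apply: eq_linear_poly => [c p p'|c p p'|m].
- by rewrite mulrDl -scalerAl linearP.
- by rewrite linearP mulrDl -scalerAl.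
move: q; apply: eq_linear_poly => [c q q'|c q q'|m'].
- by rewrite mulrDr -scalerAr linearP.
- by rewrite linearP mulrDr -scalerAr.
by rewrite -monoM !mevalE monom_evalM.
Qed.

End Evaluation.

(** * Derivations of the polynomial algebra *)

Section Derivations.
Variables (I : choiceType) (K : fieldType).
Local Notation P := (polyalg I K).
Local Notation X x := (@mono I K (ucm x)).

Definition derivation (A : comAlgType K) (D : A -> A) : Prop :=
  linear D /\ forall p q, D (p * q) = D p * q + p * D q.

Lemma linear_bundle (V W : lmodType K) (f : V -> W) :
  linear f -> exists f' : {linear V -> W}, f = f'.
Proof.
move=> lf.
by exists (HB.pack_for {linear V -> W} f (GRing.isLinear.Build K V W *:%R f lf)).
Qed.

Lemma derivation1 (A : comAlgType K) (D : A -> A) : derivation D -> D 1 = 0.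
Proof.
case=> _ /(_ 1 1); rewrite !mulr1 mul1r => /eqP.
by rewrite -subr_eq0 opprD addrA subrr sub0r oppr_eq0 => /eqP.
Qed.

Lemma derivationZD (A : comAlgType K) (J : finType) (c : J -> K)
    (D : J -> A -> A) :
  (forall j, derivation (D j)) -> derivation (fun p => \sum_j c j *: D j p).
Proof.
move=> dD; split=> [a p q|p q].
  rewrite scaler_sumr -big_split; apply: eq_bigr => j _ /=.
  by have [-> _] := dD j; rewrite scalerDr !scalerA mulrC.
rewrite mulr_suml mulr_sumr -big_split; apply: eq_bigr => j _ /=.
by have [_ ->] := dD j; rewrite scalerDr scalerAl scalerAr.
Qed.

(** Both sides of the Leibniz rule are bilinear in p and q, so monomials suffice. *)
Lemma derivation_mono (D : P -> P) : linear D ->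
  (forall m1 m2, D (mono K (mulcm m1 m2)) =
     D (mono K m1) * mono K m2 + mono K m1 * D (mono K m2)) -> derivation D.
Proof.
move=> lD; have [D' ->] := linear_bundle lD => {lD} DM.
split=> [|p q]; first exact: linearP.
move: p; apply: eq_linear_poly => [c p p'|c p p'|m1].
- by rewrite mulrDl -scalerAl linearP.
- rewrite linearP !mulrDl -!scalerAl scalerDr.
  by rewrite -!addrA; congr (_ + _); rewrite addrCA.
move: q; apply: eq_linear_poly => [c q q'|c q q'|m2].
- by rewrite mulrDr -scalerAr linearP.
- rewrite linearP !mulrDr -!scalerAr scalerDr.
  by rewrite -!addrA; congr (_ + _); rewrite addrCA.
by rewrite -monoM DM.
Qed.

Definition pder (x : I) : P -> P :=
  plin (fun m => (m x)%:R *: mono K (divcm m (ucm x))).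

Lemma pder_derivation x : derivation (pder x).
Proof.
apply: derivation_mono => [|m1 m2]; first exact: linearP.
rewrite /pder !plinE -!scalerAl -!scalerAr -!monoM mulcmE natrD scalerDl.
congr (_ + _).
  (* [divcm] truncates exponents at 0, which matters only when x does not divide m1; the coefficient
     m1 x is then 0. *)
  have [->|m1x] := eqVneq (m1 x) 0%N; first by rewrite !scale0r.
  congr (_ *: mono K _); apply/eqP/cmP => y; rewrite !(divcmE, mulcmE) ucmE.
  by case: eqP => [<-|_]; lia.
have [->|m2x] := eqVneq (m2 x) 0%N; first by rewrite !scale0r.
congr (_ *: mono K _); apply/eqP/cmP => y; rewrite !(divcmE, mulcmE) ucmE.
by case: eqP => [<-|_]; lia.
Qed.

Lemma pderX x y : pder x (X y) = (x == y)%:R.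
Proof.
rewrite /pder plinE ucmE eq_sym; case: eqP => [->|_]; last by rewrite scale0r.
rewrite scale1r -mono1; congr (mono K _); apply/eqP/cmP => z.
by rewrite divcmE onecmE subnn.
Qed.

End Derivations.

(** Course-of-values recursion: G sees all earlier values, as the Newton identities require. *)
Lemma strong_recursion (T : Type) (G : seq T -> T) :
  exists f : nat -> T, forall n, f n = G (mkseq f n).
Proof.
pose s := fix s n := if n is n'.+1 then rcons (s n') (G (s n')) else [::].
exists (fun n => G (s n)) => n; congr G.
elim: n => // n IHn; rewrite [LHS]/= /mkseq -addn1 iotaD map_cat add0n /= cats1.
by congr rcons.
Qed.

(** * Newton identities: exponentials of power series through their coefficients *)

Section Newton.
Variables (K : fieldType) (A : comAlgType K).
Hypothesis charK : [pchar K] =i pred0.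
Implicit Types p c : nat -> A.

(* The coefficients c of exp (\sum_j (p j / (j + 1)) x^(j + 1)). *)
Definition newton p c : Prop :=
  c 0%N = 1 /\ forall r, r.+1%:R *: c r.+1 = \sum_(j < r.+1) p j * c (r - j)%N.

Lemma scaleNatI n : injective (fun x : A => n.+1%:R *: x).
Proof. by apply: scalerI; rewrite ((pcharf0P K).1 charK). Qed.

Lemma newton_exists p : exists c, newton p c.
Proof.
have [c cE] := strong_recursion (fun s : seq A =>
  if size s is r.+1 then r.+1%:R^-1 *: \sum_(j < r.+1) p j * s`_(r - j) else 1).
exists c; split=> [|r]; first by rewrite cE.
rewrite cE size_mkseq scalerA mulfV ?((pcharf0P K).1 charK) // scale1r.
by apply: eq_bigr => j _; rewrite nth_mkseq // ltnS leq_subr.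
Qed.

Lemma newton_unique p c c' : newton p c -> newton p c' -> c =1 c'.
Proof.
move=> [c0 cS] [c'0 c'S]; elim/ltn_ind => -[_|r IHr]; first by rewrite c0 c'0.
apply: (@scaleNatI r); rewrite cS c'S; apply: eq_bigr => j _.
by rewrite IHr // ltnS leq_subr.
Qed.

Lemma newton0 : newton (fun=> 0) (fun r => (r == 0%N)%:R).
Proof.
by split=> // r; rewrite scaler0 big1 // => j _; rewrite mul0r.
Qed.

(** This is exp P exp Q = exp (P + Q): the identities say C' = p C for the generating series, and
    the product rule adds logarithmic derivatives. *)
Lemma newton_mul p q c d : newton p c -> newton q d ->
  newton (fun j => p j + q j) (fun r => \sum_(j < r.+1) c j * d (r - j)%N).
Proof.
move=> [c0 cS] [d0 dS]; split=> [|r]; first by rewrite big_ord1 c0 d0 mulr1.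
(* Truncating below degree r + 2 keeps coefficient r + 1 of the product exact, as well as the
   coefficients up to r of the derivatives. *)
pose N := r.+2.
pose trunc (f : nat -> A) : {poly A} := \poly_(j < N) f j.
have mulE (f g : nat -> A) (k : nat) : (k < N)%N ->
    (trunc f * trunc g)`_k = \sum_(j < k.+1) f j * g (k - j)%N.
  move=> kN; rewrite coefM; apply: eq_bigr => j _; rewrite !coef_poly.
  by rewrite (leq_ltn_trans _ kN) ?leq_ord // (leq_ltn_trans (leq_subr _ _) kN).
(* The Newton identities read as the differential equation g' = f g up to degree r. *)
have derE (f g : nat -> A) (k : nat) : newton f g -> (k < r.+1)%N ->
    (trunc g)^`()`_k = (trunc f * trunc g)`_k.
  move=> [_ gS] kr; rewrite coef_deriv coef_poly ltnS kr mulE; last exact: ltnW.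
  by rewrite -gS scaler_nat.
have coefMl (u v w : {poly A}) : (forall k, (k < r.+1)%N -> u`_k = v`_k) ->
    (u * w)`_r = (v * w)`_r.
  move=> uv; rewrite !coefM; apply: eq_bigr => j _; congr (_ * _).
  exact: uv.
rewrite -(mulE c d) // scaler_nat -coef_deriv derivM coefD.
rewrite (@coefMl _ (trunc p * trunc c)) => [|k]; last first.
  by apply: derE; split.
rewrite mulrC [_ * (trunc d)^`()]mulrC.
rewrite [in X in _ + X](@coefMl _ (trunc q * trunc d)) => [|k]; last first.
  by apply: derE; split.
rewrite mulrC.
have -> : trunc p * trunc c * trunc d = trunc p * (trunc c * trunc d).
  by rewrite mulrA.
have -> : trunc q * trunc d * trunc c = trunc q * (trunc c * trunc d).
  by rewrite -mulrA [trunc d * _]mulrC.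
rewrite -coefD -mulrDl coefM; apply: eq_bigr => j _.
rewrite coefD !coef_poly ltnS ltnW // mulE //.
by rewrite ltnS ltnW // ltnS leq_subr.
Qed.

(** D maps the exponent \sum_j p_j x^(j+1) / (j+1) to a x^(n+1), hence the exponential c(x) to a
    x^(n+1) c(x). *)
Lemma derivation_newton p c D n (a : K) : derivation D -> newton p c ->
  (forall j, D (p j) = if j == n then (n.+1%:R * a)%:A else 0) ->
  forall r, D (c r) = if (n < r)%N then a *: c (r - n.+1)%N else 0.
Proof.
move=> dD [c0 cS] Dp; have [lD DM] := dD.
elim/ltn_ind => -[_|r IHr]; first by rewrite c0 derivation1.
apply: (@scaleNatI r) => /=; have [D' DE] := linear_bundle lD.
rewrite {1}DE -linearZ cS linear_sum /= -DE.
under eq_bigr => j _ do rewrite DM Dp IHr ?ltnS ?leq_subr //.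
rewrite big_split /= ltnS subSS.
have [nr|rn] := leqP n r; last first.
  rewrite scaler0 !big1 ?addr0 // => j _.
    by rewrite ifF ?mulr0 //; apply/negbTE; rewrite -leqNgt; lia.
  by rewrite ifF ?mul0r //; apply/negbTE; have := ltn_ord j; lia.
(* The first sum gives (n+1) a c_(r-n), from j = n alone; the second gives a (r-n) c_(r-n), by the
   Newton identity for the index r - n. Together they make (r+1) a c_(r-n). *)
rewrite (bigD1 (Ordinal (nr : (n < r.+1)%N))) //= eqxx big1 ?addr0; last first.
  by move=> j /negbTE; rewrite -val_eqE /= => ->; rewrite mul0r.
have -> : \sum_(j < r.+1) p j * (if (n < r - j)%N then
    a *: c (r - j - n.+1)%N else 0) = a *: ((r - n)%:R *: c (r - n)%N).
  have [->|nr'] := eqVneq n r.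
    rewrite subnn scale0r scaler0 big1 // => j _.
    by rewrite ifF ?mulr0 //; apply/negbTE; rewrite -leqNgt leq_subr.
  have [k rE] : exists k, r = (n + k.+1)%N by exists (r - n.+1)%N; lia.
  rewrite {}rE {nr nr' IHr} addKn cS scaler_sumr.
  rewrite (@big_ord_widen _ _ _ k.+1 (n + k.+1).+1
    (fun j => a *: (p j * c (k - j)%N))) ?ltnS ?leq_addl //; last by lia.
  rewrite [RHS]big_mkcond /=.
  apply: eq_bigr => j _; case: ifP => jk; last first.
    by rewrite ifF ?mulr0 //; lia.
  rewrite ifT; last by lia.
  by rewrite scalerAr; congr (_ * (_ *: c _)); lia.
rewrite -scalerAl mul1r scalerA -scalerDl.
rewrite scalerA; congr (_ *: _).
by rewrite mulrC -mulrDr -natrD [RHS]mulrC; congr (_ * _%:R); lia.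
Qed.

Definition newton_sol p : nat -> A := projT1 (cid (newton_exists p)).

Lemma newton_solP p : newton p (newton_sol p).
Proof. exact: projT2 (cid (newton_exists p)). Qed.

End Newton.

(** * Linear spans and linearly closed predicates *)

Section Span.
Variables (K : fieldType) (V : lmodType K).
Implicit Types (S G : V -> Prop) (v w : V).

Definition lin_closed S : Prop :=
  S 0 /\ forall c v w, S v -> S w -> S (c *: v + w).

(** An inductive counterpart of [lin_span] (see [lin_spanE]), which gives induction on linear
    combinations. *)
Inductive span_of G : V -> Prop :=
| SpanZero : span_of G 0
| SpanAdd c g v : G g -> span_of G v -> span_of G (c *: g + v).

Lemma lin_closedZ S c v : lin_closed S -> S v -> S (c *: v).
Proof. by move=> [S0 SD] Sv; rewrite -[_ *: _]addr0; apply: SD. Qed.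

Lemma lin_closedD S v w : lin_closed S -> S v -> S w -> S (v + w).
Proof. by move=> [_ SD] Sv Sw; rewrite -[v]scale1r; apply: SD. Qed.

Lemma lin_closedN S v : lin_closed S -> S v -> S (- v).
Proof. by move=> Scl Sv; rewrite -scaleN1r; apply: lin_closedZ. Qed.

Lemma lin_closed_sum S (J : Type) (r : seq J) (Q : pred J) (F : J -> V) :
  lin_closed S -> (forall j, Q j -> S (F j)) -> S (\sum_(j <- r | Q j) F j).
Proof.
move=> Scl SF; elim/big_ind: _ => //; first by case: Scl.
by move=> v w; apply: lin_closedD.
Qed.

Lemma span_lin_closed G : lin_closed (span_of G).
Proof.
split=> [|c v w Gv Gw]; first exact: SpanZero.
elim: Gv => [|d g u Gg _ IHu]; first by rewrite scaler0 add0r.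
by rewrite scalerDr scalerA -addrA; apply: SpanAdd.
Qed.

Lemma span_gen G v : G v -> span_of G v.
Proof.
by move=> Gv; rewrite -[v]addr0 -[v]scale1r; apply: SpanAdd => //; apply: SpanZero.
Qed.

Lemma span_sub G S v : span_of G v -> lin_closed S ->
  (forall w, G w -> S w) -> S v.
Proof.
by move=> Gv [S0 SD] GS; elim: Gv => // c g w Gg _ Sw; apply: SD => //; apply: GS.
Qed.

End Span.

Lemma lin_closed_preim (K : fieldType) (V W : lmodType K) (f : V -> W)
    (S : W -> Prop) : linear f -> lin_closed S -> lin_closed (S \o f).
Proof.
move=> lf; have [f' ->] := linear_bundle lf => {f lf} [[S0 SD]].
by split=> [|c v w] /=; [rewrite linear0|rewrite linearP; apply: SD].
Qed.

(** * Polynomials in a family h with bounded colour degrees and fixed weight *)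

Section Filtration.
Variables (K : fieldType) (l : nat).
Local Notation I := ('I_l * nat)%type.
Local Notation P := (polyalg I K).
Implicit Types (h : I -> P) (b : 'rV[int]_l) (e : int) (m : {cmonom I}).

Definition wt m : nat := wdeg (fun x => x.2.+1) m.

Definition mdegs m : 'rV[int]_l :=
  \row_j (wdeg (fun x => (x.1 == j) : nat) m)%:Z.

Lemma wtM m1 m2 : wt (mulcm m1 m2) = (wt m1 + wt m2)%N.
Proof. exact: wdegM. Qed.

Lemma mdegsM m1 m2 : mdegs (mulcm m1 m2) = mdegs m1 + mdegs m2.
Proof. by apply/rowP => j; rewrite !mxE wdegM PoszD. Qed.

Lemma mdegs1 : mdegs (onecm _) = 0.
Proof. by apply/rowP => j; rewrite !mxE wdeg1. Qed.

Lemma mdegsU x : mdegs (ucm x) = delta_mx 0 x.1.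
Proof.
by apply/rowP => j; rewrite !mxE wdegU eqxx eq_sym /=; case: (j == x.1).
Qed.

Lemma mdegs_ge0 m j : 0 <= mdegs m 0 j.
Proof. by rewrite mxE. Qed.

Definition bounded b m : Prop := forall j, mdegs m 0 j <= b 0 j.

(** The weight e is an integer, so that lowering operators may subtract freely; a negative weight
    leaves only 0 ([filt_neg]). *)
Definition filt h b e : P -> Prop :=
  span_of (fun v => exists m,
    [/\ v = monom_eval h m, bounded b m & (wt m)%:Z = e]).

Lemma filt_lin_closed h b e : lin_closed (filt h b e).
Proof. exact: span_lin_closed. Qed.

Lemma filt_mono h b m : bounded b m -> filt h b (wt m)%:Z (monom_eval h m).
Proof. by move=> mb; apply: span_gen; exists m. Qed.

Lemma filt_le h b b' e p : (forall j, b 0 j <= b' 0 j) ->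
  filt h b e p -> filt h b' e p.
Proof.
move=> le_b fp; apply: (span_sub fp); first exact: filt_lin_closed.
move=> _ [m [-> mb <-]]; apply: filt_mono => j.
exact: le_trans (mb j) (le_b j).
Qed.

Lemma filt1 h : filt h 0 0 1.
Proof.
apply: span_gen; exists (onecm _); split; last by rewrite /wt wdeg1.
  by rewrite /monom_eval mdom1 big_seq_fset0.
by move=> j; rewrite mdegs1.
Qed.

Lemma filtX h x : filt h (delta_mx 0 x.1) x.2.+1 (h x).
Proof.
apply: span_gen; exists (ucm x); split; last by rewrite /wt wdegU.
  by rewrite -mevalE mevalX.
by move=> j; rewrite mdegsU.
Qed.

Lemma filtM h b1 b2 e1 e2 p q : filt h b1 e1 p -> filt h b2 e2 q ->
  filt h (b1 + b2) (e1 + e2) (p * q).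
Proof.
move=> fp fq; apply: (span_sub fp (S := fun p => filt h (b1 + b2) (e1 + e2) (p * q))).
  apply: (@lin_closed_preim _ _ _ (fun p => p * q)); last exact: filt_lin_closed.
  by move=> c u v; rewrite mulrDl scalerAl.
move=> _ [m1 [-> m1b <-]].
apply: (span_sub fq (S := fun q => filt h (b1 + b2) ((wt m1)%:Z + e2) (monom_eval h m1 * q))).
  apply: (@lin_closed_preim _ _ _ (fun q => _ * q)); last exact: filt_lin_closed.
  by move=> c u v; rewrite mulrDr scalerAr.
move=> _ [m2 [-> m2b <-]]; rewrite -monom_evalM -PoszD -wtM.
by apply: filt_mono => j; rewrite mdegsM mxE [leRHS]mxE; apply: lerD.
Qed.

Lemma filt_neg h b e p : e < 0 -> filt h b e p -> p = 0.
Proof.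
move=> e0 fp; apply: (span_sub fp (S := fun p => p = 0)) => [|v [m [_ _ eE]]]; last first.
  by rewrite -eE in e0.
by split=> // c v w -> ->; rewrite scaler0 addr0.
Qed.

(** By the Leibniz rule, it is enough that D lowers the weight of each generator h x by n without
    raising its colour degree. *)
Lemma filt_derivation h b e n (D : P -> P) p : derivation D ->
  (forall x, filt h (delta_mx 0 x.1) (x.2.+1%:Z - n) (D (h x))) ->
  filt h b e p -> filt h b (e - n) (D p).
Proof.
move=> dD Dh; have [lD DM] := dD.
move=> fp; apply: (span_sub fp (S := fun q => filt h b (e - n) (D q))).
  exact: lin_closed_preim lD (filt_lin_closed _ _ _).
(* Replacing b by the exact degrees of m makes the bound additive, as the induction on m
   requires. *)
move=> _ [m [-> mb <-]] /=; apply: (filt_le mb) => {mb}.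
elim/cmonom_ind: m => [|x m IHm].
  rewrite /monom_eval mdom1 big_seq_fset0 derivation1 //.
  by case: (filt_lin_closed h (mdegs (onecm I)) ((wt (onecm I))%:Z - n)).
rewrite monom_evalM DM -mevalE mevalX mdegsM mdegsU wtM PoszD.
apply: (lin_closedD (filt_lin_closed h _ _)).
  have -> : wt (ucm x) = x.2.+1 by rewrite /wt wdegU.
  by rewrite addrAC; apply: filtM => //; apply: filt_mono.
rewrite -addrA; have -> : wt (ucm x) = x.2.+1 by rewrite /wt wdegU.
by apply: filtM => //; apply: filtX.
Qed.

End Filtration.

(** * The complete symmetric functions h_(i,r) as generators of M(1) *)

Section CompleteSymmetric.
Variables (K : fieldType) (l : nat).
Hypothesis charK : [pchar K] =i pred0.
Local Notation I := ('I_l * nat)%type.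
Local Notation P := (polyalg I K).
Local Notation X i k := (@mono I K (ucm (i, k))).

(* \sum_r complete i r x^r = exp (\sum_(k >= 1) alpha_i(-k) x^k / k) *)
Definition complete (i : 'I_l) : nat -> P :=
  newton_sol charK (fun k => X i k).

(** The shift by 1 leaves out h_(i,0) = 1 and gives [hgen (i, k)] the same weight as the variable
    (i, k). *)
Definition hgen (x : I) : P := complete x.1 x.2.+1.

Lemma completeP i : newton (fun k => X i k) (complete i).
Proof. exact: newton_solP. Qed.

Lemma filt_complete i r : filt hgen (delta_mx 0 i) r%:Z (complete i r).
Proof.
case: r => [|r]; last exact: (filtX hgen (i, r)).
case: (completeP i) => -> _; apply: filt_le (filt1 hgen) => j.
by rewrite !mxE; case: (_ && _).
Qed.

(** The witness c is the coefficient sequence of \prod_i h_i(x)^(b_i): one factor at a time,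
    [newton_mul] adds the exponents and [filtM] adds the degree bounds. *)
Lemma filt_newton (b : 'I_l -> nat) : exists c,
  newton (fun k => \sum_i X i k *+ b i) c /\
  forall r : nat, filt hgen (\sum_i delta_mx 0 i *+ b i) r%:Z (c r).
Proof.
pose Q (p : nat -> P) (a : 'rV[int]_l) := exists c,
  newton p c /\ forall r : nat, filt hgen a r%:Z (c r).
have Q0 : Q (fun=> 0) 0.
  exists (fun r => (r == 0%N)%:R); split=> [|r]; first exact: newton0.
  case: eqP => [->|_]; first exact: filt1.
  by case: (filt_lin_closed hgen (0 : 'rV_l) r%:Z).
have QD p q a a' : Q p a -> Q q a' -> Q (fun k => p k + q k) (a + a').
  move=> [c [pc fc]] [d [qd fd]].
  exists (fun r => \sum_(j < r.+1) c j * d (r - j)%N).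
  split=> [|r]; first exact: newton_mul.
  apply: lin_closed_sum => [|j _]; first exact: filt_lin_closed.
  have {1}-> : r = (j + (r - j))%N by rewrite subnKC // leq_ord.
  by rewrite PoszD; apply: filtM.
have QMn i n : Q (fun k => X i k *+ n) (delta_mx 0 i *+ n).
  elim: n => [|n IHn]; first exact: Q0.
  rewrite mulrS; suff -> : (fun k => X i k *+ n.+1) = (fun k => X i k + X i k *+ n).
    by apply: QD => //; exists (complete i); split;
      [apply: completeP|apply: filt_complete].
  by apply/funext => k; rewrite mulrS.
suff : Q (fun k => \sum_i X i k *+ b i) (\sum_i delta_mx 0 i *+ b i) by [].
elim: (index_enum _) => [|i s IHs].
  rewrite big_nil; suff -> : (fun k => \sum_(i <- [::]) X i k *+ b i) = (fun=> 0).
    by [].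
  by apply/funext => k; rewrite big_nil.
rewrite big_cons; suff -> : (fun k => \sum_(i <- i :: s) X i k *+ b i) =
  (fun k => X i k *+ b i + \sum_(i <- s) X i k *+ b i) by apply: QD.
by apply/funext => k; rewrite big_cons.
Qed.

(* psi expresses the power sums through the complete symmetric functions, by
   solving Newton's identities in the other direction. *)
Lemma meval_hgenK : exists psi : I -> P,
  forall p, meval psi (meval hgen p) = p.
Proof.
have ex_psi i : exists f : nat -> P, forall k,
    f k = k.+1%:R *: X i k - \sum_(j < k) f j * X i (k.-1 - j)%N.
  have [f fE] := strong_recursion (fun s : seq P =>
    (size s).+1%:R *: X i (size s) -
    \sum_(j < size s) s`_j * X i ((size s).-1 - j)%N).
  exists f => k; rewrite fE size_mkseq; congr (_ - _).
  by apply: eq_bigr => j _; rewrite nth_mkseq.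
have [psi psiE] := choice ex_psi.
exists (fun x => psi x.1 x.2); set psi' := fun x => _.
(* Substituting [psi'] turns the Newton identities of h_i into those with power sums psi i; the
   sequence 1, X i 0, X i 1, ... solves the same identities by the choice of psi, and uniqueness
   identifies the two. *)
have evE i : (fun r => meval psi' (complete i r)) =1
    (fun r => if r is k.+1 then X i k else 1).
  apply: (newton_unique charK (p := psi i)).
    have [c0 cS] := completeP i; split=> [|r]; first by rewrite c0 meval1.
    rewrite -linearZ cS linear_sum /=; apply: eq_bigr => j _.
    by rewrite mevalM mevalX.
  split=> // r; rewrite big_ord_recr /= subnn mulr1 psiE.
  rewrite addrC [Y in _ - Y](eq_bigr (fun j : 'I_r => psi i j *
    (if (r - j)%N is k.+1 then X i k else 1))) ?subrK // => j _.
  by case: r j => [[]//|r] j; rewrite subSn // leq_ord.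
move=> p; move: p; apply: eq_linear_poly => [c p q|c p q|m].
- by rewrite !linearP.
- by [].
rewrite mevalE; elim/cmonom_ind: m => [|[i k] m IHm].
  by rewrite /monom_eval mdom1 big_seq_fset0 meval1 mono1.
rewrite monom_evalM mevalM IHm monoM -mevalE mevalX; congr (_ * _).
exact: (evE i k.+1).
Qed.

Lemma meval_hgen_inj : injective (meval hgen).
Proof. by have [psi psiK] := meval_hgenK; apply: can_inj psiK. Qed.

End CompleteSymmetric.

(** * Coefficients of exponentials of operators *)

Section ExpCoef.
Variable K : fieldType.

(** [exp_coef] on an arbitrary module, convertible to it on [VQ]; this lets exponentials be moved
    between [VQ] and the polynomial algebra by [gexp_map]. *)
Definition gexp (V : lmodType K) (A : nat -> V -> V) (r : nat) (v : V) : V :=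
  \sum_(k < r.+1) (k`!%:R)^-1 *:
    \sum_(n : k.-tuple 'I_r.+1 |
            all (fun j : 'I_r.+1 => (0 < j)%N) n && (\sum_(j <- n) j == r)%N)
      foldr (fun (j : 'I_r.+1) w => A j w) v n.

Lemma gexp0 (V : lmodType K) (A : nat -> V -> V) v : gexp A 0 v = v.
Proof.
rewrite /gexp big_ord1 fact0 invr1 scale1r (big_pred1 [tuple]) //= => n.
by rewrite [n]tuple0 /= big_nil.
Qed.

Lemma gexp_closed (V : lmodType K) (A : nat -> V -> V) (S : int -> V -> Prop)
    e r v :
  (forall e, lin_closed (S e)) ->
  (forall j e w, (0 < j)%N -> S e w -> S (e - j%:Z) (A j w)) ->
  S e v -> S (e - r%:Z) (gexp A r v).
Proof.
move=> Scl SA Sv; apply: (lin_closed_sum _ (Scl _)) => k _.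
apply: lin_closedZ => //; apply: (lin_closed_sum _ (Scl _)) => n.
case/andP => n_pos /eqP n_r.
suff : S (e - (\sum_(j <- n) j)%N%:Z)
  (foldr (fun (j : 'I_r.+1) w => A j w) v n) by rewrite n_r.
elim: (tval n) n_pos => [_|j s IHs] /=; first by rewrite big_nil subr0.
case/andP => j_gt0 /IHs Ss; rewrite big_cons PoszD opprD addrCA addrC.
exact: SA.
Qed.

Lemma gexp_map (V W : lmodType K) (f : V -> W) A B r v : linear f ->
  (forall j w, (0 < j)%N -> f (A j w) = B j (f w)) ->
  f (gexp A r v) = gexp B r (f v).
Proof.
move=> lf; have [f' ->] := linear_bundle lf => {f lf} fA.
rewrite linear_sum; apply: eq_bigr => k _; rewrite linearZ /=; congr (_ *: _).
rewrite linear_sum; apply: eq_bigr => n /andP[+ _].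
by elim: (tval n) => //= j s IHs /andP[j_gt0 /IHs <-]; rewrite fA.
Qed.

Lemma gexp_linear (V : lmodType K) (A : nat -> V -> V) r :
  (forall j, linear (A j)) -> linear (gexp A r).
Proof.
move=> lA c v w; rewrite /gexp scaler_sumr -big_split; apply: eq_bigr => k _ /=.
rewrite scalerA mulrC -scalerA -scalerDr; congr (_ *: _).
rewrite scaler_sumr -big_split; apply: eq_bigr => n _ /=.
by elim: (tval n) => //= j s ->; rewrite lA.
Qed.

Section Multiplication.
Variables (A : comAlgType K) (a : nat -> A).

Definition mul_exp : nat -> A -> A := gexp (fun n w => a n * w).

Lemma mul_expE r v : mul_exp r v = mul_exp r 1 * v.
Proof.
rewrite /mul_exp; have {1}-> : v = 1 * v by rewrite mul1r.
apply/esym/(@gexp_map _ _ (fun p => p * v)) => [c p q|j w _].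
  by rewrite mulrDl scalerAl.
by rewrite mulrA.
Qed.

Let ser N : {poly A} := \poly_(j < N) (if j is 0%N then 0 else a j).

Lemma coef_ser_exp N k r : (r < N)%N -> (ser N ^+ k)`_r =
  \sum_(n : k.-tuple 'I_r.+1 |
          all (fun j : 'I_r.+1 => (0 < j)%N) n && (\sum_(j <- n) j == r)%N)
    foldr (fun (j : 'I_r.+1) w => a j * w) 1 n.
Proof.
(* Setting b 0 = 0 encodes the condition that all indices of a tuple be positive. *)
move=> rN; pose b j := if j is 0%N then 0 else a j.
have -> : (ser N ^+ k)`_r = (ser r.+1 ^+ k)`_r.
  (* The coefficient index s is separated from the truncation order r.+1, so that the induction on k
     covers all s <= r. *)
  have [s] : exists s, s = r by exists r.
  move=> sr; rewrite -{1 3}sr; have {sr} : (s <= r)%N by rewrite sr.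
  elim: k s => [|k IHk] s sr; first by rewrite !expr0.
  rewrite !exprS !coefM; apply: eq_bigr => j _; rewrite IHk; last first.
    by rewrite (leq_trans (leq_subr _ _)).
  have jr : (j <= r)%N by rewrite (leq_trans _ sr) // leq_ord.
  by rewrite !coef_poly ltnS jr (leq_ltn_trans jr rN).
rewrite -{1}[k]card_ord -prodr_const /ser poly_def bigA_distr_bigA /=.
rewrite coef_sum.
rewrite (reindex (fun n : k.-tuple 'I_r.+1 => [ffun i => tnth n i])) /=; last first.
  exists (fun f : {ffun 'I_k -> 'I_r.+1} => [tuple f i | i < k]) => [n|f] _.
    by apply: eq_from_tnth => i; rewrite tnth_mktuple ffunE.
  by apply/ffunP => i; rewrite ffunE tnth_mktuple.
rewrite [RHS]big_mkcond; apply: eq_bigr => n _.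
have -> : \prod_(i < k) (b ([ffun i => tnth n i] i) *: 'X^([ffun i => tnth n i] i)) =
    (\prod_(j <- n) b j) *: 'X^(\sum_(j <- n) j).
  rewrite !big_tuple scaler_prod.
  under eq_bigr => i _ do rewrite ffunE.
  under [in X in _ *: X = _]eq_bigr => i _ do rewrite ffunE.
  by congr (_ *: _); rewrite (big_morph (fun n => 'X^n) (exprD _) (expr0 _)).
rewrite coefZ coefXn eq_sym.
case: (_ == r); rewrite ?andbF ?mulr0 // andbT mulr1.
elim: (tval n) => [|j s IHs]; first by rewrite big_nil.
rewrite big_cons IHs /=; case: j => -[|j] jr //=; first by rewrite mul0r.
by case: ifP => // _; rewrite mulr0.
Qed.

(** E = exp S satisfies E' = S' E, and the Newton identities are this equation coefficient by
    coefficient. *)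
Lemma newton_mul_exp : [pchar K] =i pred0 ->
  newton (fun j => j.+1%:R *: a j.+1) (fun r => mul_exp r 1).
Proof.
move=> charK.
(* M cuts the exponential series and N its exponent; coefficient r is exact once both exceed r. *)
pose E M N : {poly A} := \sum_(k < M) (k`!%:R^-1 : K)%:A *: ser N ^+ k.
have coefE M N r : (r < M)%N -> (r < N)%N -> (E M N)`_r = mul_exp r 1.
  move=> rM rN; rewrite coef_sum (bigID (fun k : 'I_M => (k < r.+1)%N)) /=.
  rewrite [X in _ + X]big1 ?addr0 => [|k]; last first.
    rewrite -leqNgt => rk; rewrite coefZ.
    (* The exponent is divisible by the variable, so its k-th power has no coefficient in degree r <
       k. *)
    pose t : {poly A} := \poly_(j < N.-1) a j.+1.
    have -> : ser N = t * 'X.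
      apply/polyP => -[|j]; rewrite coefMX !coef_poly /=; first by case: ifP.
      by congr (if _ then _ else _); lia.
    by rewrite exprMn coefMXn rk mulr0.
  rewrite -(big_ord_widen M (fun k => ((k`!%:R^-1 : K)%:A *: ser N ^+ k)`_r)) //.
  by apply: eq_bigr => k _; rewrite coefZ coef_ser_exp // mulr_algl.
split=> [|r]; first exact: gexp0.
rewrite -(coefE r.+2 r.+2) // scaler_nat -coef_deriv.
(* Differentiating turns each term of the exponential into the preceding one times the derivative of
   the exponent, hence one term fewer on the right. *)
have -> : (E r.+2 r.+2)^`() = (ser r.+2)^`() * E r.+1 r.+2.
  rewrite /E linear_sum big_ord_recl /= expr0 derivZ -polyC1 derivC scaler0.
  rewrite add0r mulr_sumr; apply: eq_bigr => k _; rewrite derivZ deriv_exp.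
  rewrite -scalerAr /= -scaler_nat scalerA; congr (_ *: _).
  rewrite -scaler_nat -scalerAl mul1r scalerA factS natrM invfM.
  by rewrite mulrAC mulVf ?mul1r // ((pcharf0P K).1 charK).
rewrite coefM; apply: eq_bigr => j _; rewrite coef_deriv coef_poly !ltnS leq_ord.
by rewrite scaler_nat coefE // ltnS ?leqW // leq_subr.
Qed.

End Multiplication.
End ExpCoef.

Lemma linear_scaled_sum (K : fieldType) (V W : lmodType K) (J : finType) (a : K)
    (F : J -> V -> W) :
  (forall j, linear (F j)) -> linear (fun v => a *: \sum_j F j v).
Proof.
move=> lF c v w; rewrite scalerA mulrC -scalerA -scalerDr; congr (_ *: _).
by rewrite scaler_sumr -big_split; apply: eq_bigr => j _; rewrite lF.
Qed.

(** A sum that is finite on each monomial, but without a uniform bound, is handled as the eventual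
    value of its truncations; a linear combination takes the maximum of the bounds. *)
Lemma eventually_eq_linear (I : choiceType) (K : fieldType) (V : lmodType K)
    (f : polyalg I K -> V) (g : nat -> polyalg I K -> V) :
  linear f -> (forall N, linear (g N)) ->
  (forall m, exists N, forall N', (N <= N')%N -> f (mono K m) = g N' (mono K m)) ->
  forall p, exists N, forall N', (N <= N')%N -> f p = g N' p.
Proof.
move=> lf lg fg; elim/poly_ind => [|c m p [N pN]].
  exists 0%N => N' _; have [f' ->] := linear_bundle lf.
  by have [g' ->] := linear_bundle (lg N'); rewrite !linear0.
have [N1 mN1] := fg m; exists (maxn N N1) => N'.
by rewrite geq_max lf lg => /andP[/pN -> /mN1 ->].
Qed.

(** * Heisenberg and vertex operators on the vectors p (x) e^b *)

Section LatticeVertexOperators.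
Variables (K : fieldType) (l : nat) (M : 'M[int]_l).
Local Notation I := ('I_l * nat)%type.
Local Notation P := (polyalg I K).
Local Notation VQ := (VQ K l).
Local Notation X i k := (@mono I K (ucm (i, k))).
Implicit Types (a b : 'rV[int]_l) (p : P).

Lemma lin_ext_is_linear (F : VQbasis l -> VQ) : linear (lin_ext F).
Proof. exact: mlin_is_linear. Qed.

HB.instance Definition _ (F : VQbasis l -> VQ) :=
  GRing.isLinear.Build K VQ VQ *:%R (lin_ext F) (lin_ext_is_linear F).

Lemma lin_extE (F : VQbasis l -> VQ) u : lin_ext F (VQvec K u) = F u.
Proof. exact: mlinU. Qed.

(* The embedding p |-> p (x) e^b of M(1) in V_Q *)
Definition vec b : P -> VQ := plin (fun m => VQvec K (m, b)).

HB.instance Definition _ b := GRing.Linear.on (vec b).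

Lemma vecE b m : vec b (mono K m) = VQvec K (m, b).
Proof. exact: plinE. Qed.

Lemma eq_linear_VQ (V : lmodType K) (f g : VQ -> V) : linear f -> linear g ->
  (forall b m, f (vec b (mono K m)) = g (vec b (mono K m))) -> f =1 g.
Proof.
move=> lf lg fg; apply: eq_linear_malg => // -[m b].
by have := fg b m; rewrite !vecE.
Qed.

Lemma linear_vec b : linear (vec b). Proof. exact: linearP. Qed.

HB.instance Definition _ i n :=
  GRing.isLinear.Build K VQ VQ *:%R (heis M i n)
    (lin_ext_is_linear (heis_basis K M i n)).

Lemma heis_Negz i k b p :
  heis M i (Negz k) (vec b p) = vec b (X i k * p).
Proof.
move: p; apply: eq_linear_poly => [c p q|c p q|m]; first by rewrite !linearP.
  by rewrite mulrDr -scalerAr linearP.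
by rewrite -monoM !vecE /heis lin_extE /= mulcmC.
Qed.

Lemma heis0 i b p :
  heis M i 0 (vec b p) = (lattice_form M (delta_mx 0 i) b)%:~R *: vec b p.
Proof.
move: p; apply: eq_linear_poly => [c p q|c p q|m]; first by rewrite !linearP.
  by rewrite linearP scalerDr !scalerA mulrC.
by rewrite !vecE /heis lin_extE.
Qed.

Lemma heisS i k b p : heis M i k.+1%:Z (vec b p) =
  vec b (\sum_j (k.+1%:R * (M i j)%:~R) *: pder (j, k) p).
Proof.
move: p; apply: eq_linear_poly => [c p q|c p q|m]; first by rewrite !linearP.
  have [] := derivationZD (fun j => k.+1%:R * (M i j)%:~R : K)
    (fun j => pder_derivation K (j, k)).
  by move=> lD _; rewrite lD linearP.
rewrite vecE /heis lin_extE linear_sum; apply: eq_bigr => j _.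
by rewrite /pder plinE !linearZ /= vecE scalerA.
Qed.

(** The operator a(-k-1) is multiplication by this element. *)
Definition raise a k : P := \sum_i (a 0 i)%:~R *: X i k.

(** The derivation by which a(k+1) acts on M(1). *)
Definition lower a k p : P :=
  \sum_j (k.+1%:R * ((a *m M) 0 j)%:~R) *: pder (j, k) p.

Lemma lower_derivation a k : derivation (lower a k).
Proof. by apply: derivationZD => j; apply: pder_derivation. Qed.

Lemma lattice_heis_raise a k b p :
  lattice_heis M a (- k.+1%:Z) (vec b p) = vec b (raise a k * p).
Proof.
rewrite mulr_suml linear_sum; apply: eq_bigr => i _.
by rewrite -NegzE heis_Negz -scalerAl linearZ.
Qed.

Lemma lattice_heis_lower a k b p :
  lattice_heis M a k.+1%:Z (vec b p) = vec b (lower a k p).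
Proof.
rewrite /lattice_heis; under eq_bigr => i _ do rewrite heisS -linearZ scaler_sumr.
rewrite -linear_sum exchange_big; congr (vec b _); apply: eq_bigr => j _ /=.
rewrite mxE rmorph_sum mulr_sumr scaler_suml; apply: eq_bigr => i _.
by rewrite scalerA rmorphM /= mulrCA.
Qed.

Lemma lowerX a k i j :
  lower a k (X i j) = if j == k then (k.+1%:R * ((a *m M) 0 i)%:~R)%:A else 0.
Proof.
rewrite /lower (bigD1 i) //= big1 ?addr0 => [|i' /negbTE ii'].
  by rewrite pderX xpair_eqE eqxx /= eq_sym; case: (j == k); rewrite ?scaler0.
by rewrite pderX xpair_eqE ii' scaler0.
Qed.

(* The coefficients of x^r and x^-s in the two exponentials of Y(e^a, x) *)
Definition exp_raise a : nat -> P :=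
  fun r => mul_exp (fun n => n%:R^-1 *: raise a n.-1) r 1.

Definition exp_lower a : nat -> P -> P :=
  gexp (fun n w => - n%:R^-1 *: lower a n.-1 w).

Lemma exp_coef_raise a r b p :
  exp_coef (fun n w => n%:R^-1 *: lattice_heis M a (- n%:Z) w) r (vec b p) =
  vec b (exp_raise a r * p).
Proof.
rewrite /exp_raise -mul_expE; apply/esym/gexp_map; first exact: linear_vec.
by move=> [//|j] w _; rewrite lattice_heis_raise -scalerAl linearZ.
Qed.

Lemma exp_coef_lower a s b p :
  exp_coef (fun n w => - n%:R^-1 *: lattice_heis M a n%:Z w) s (vec b p) =
  vec b (exp_lower a s p).
Proof.
apply/esym/gexp_map; first exact: linear_vec.
by move=> [//|j] w _; rewrite lattice_heis_lower linearZ.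
Qed.

Lemma exp_coef_raise_lower a r s b m :
  exp_coef (fun n w => n%:R^-1 *: lattice_heis M a (- n%:Z) w) r
    (exp_coef (fun n w => - n%:R^-1 *: lattice_heis M a n%:Z w) s
      (VQvec K (m, b))) =
  vec b (exp_raise a r * exp_lower a s (mono K m)).
Proof.
apply: etrans (exp_coef_raise a r b _); congr (exp_coef _ _ _).
by rewrite -vecE; apply: exp_coef_lower.
Qed.

Lemma exp_lower_linear a s : linear (exp_lower a s).
Proof.
apply: gexp_linear => n c v w.
have [lD _] := lower_derivation a n.-1.
by rewrite lD scalerDr !scalerA mulrC.
Qed.

(** The family h is left open for two uses: the variables themselves give the vanishing
    [exp_lower_mono_eq0], and [hgen] gives [filt_exp_lower]. *)
Lemma exp_lower_filt (h : I -> P) a b e s p :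
  (forall k x, filt h (delta_mx 0 x.1) (x.2.+1%:Z - k.+1%:Z) (lower a k (h x))) ->
  filt h b e p -> filt h b (e - s%:Z) (exp_lower a s p).
Proof.
move=> fh fp; apply: (gexp_closed (S := fun e => filt h b e)) => //.
  by move=> e'; apply: filt_lin_closed.
move=> [//|k] e' w _ fw; apply: lin_closedZ; first exact: filt_lin_closed.
by apply: filt_derivation fw => //; apply: lower_derivation.
Qed.

Lemma monom_eval_mono (m : {cmonom I}) :
  monom_eval (fun x => mono K (ucm x)) m = mono K m.
Proof.
elim/cmonom_ind: m => [|x m IHm].
  by rewrite /monom_eval mdom1 big_seq_fset0 mono1.
by rewrite monom_evalM IHm -[in LHS]mevalE mevalX monoM.
Qed.

Lemma exp_lower_mono_eq0 a s (m : {cmonom I}) :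
  (wt m < s)%N -> exp_lower a s (mono K m) = 0.
Proof.
move=> ms; pose h x := mono K (ucm x) : P.
apply: (@filt_neg _ _ h (mdegs m) ((wt m)%:Z - s%:Z)); first by lia.
apply: exp_lower_filt => [k [i j] /=|]; last first.
  by rewrite -monom_eval_mono; apply: filt_mono => j.
rewrite lowerX; case: eqP => [->|_]; last first.
  by case: (filt_lin_closed h (delta_mx 0 i) (j.+1%:Z - k.+1%:Z)).
rewrite subrr; apply: lin_closedZ; first exact: filt_lin_closed.
by apply: filt_le (filt1 h) => i'; rewrite !mxE; case: (_ && _).
Qed.

(** The pairs are parametrized by s alone, with r = s + d - c when this is nonnegative; N bounds s
    and makes the sum an ordinary one. *)
Lemma fsbig_antidiagonal (V : zmodType) (F : nat * nat -> V) (c d : int) N :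
  (forall rs, (N <= rs.2)%N -> F rs = 0) ->
  \sum_(rs \in [set rs : nat * nat | rs.1%:Z - rs.2%:Z + c = d]) F rs =
  \sum_(s < N) if s%:Z + d - c is Posz r then F (r, s : nat) else 0.
Proof.
move=> F0; pose D := [set s : nat | (s < N)%N /\ 0 <= s%:Z + d - c].
pose g (s : nat) := (absz (s%:Z + d - c)%R, s).
pose B := [set rs : nat * nat | rs.1%:Z - rs.2%:Z + c = d /\ (rs.2 < N)%N].
rewrite -(@fsbig_widen _ _ _ _ B); first last.
- move=> [r s] /= [E nB]; apply: F0 => /=; rewrite leqNgt; apply/negP => sN.
  by apply: nB.
- by move=> rs [].
rewrite (@reindex_fsbig _ _ _ _ _ g D); last first.
  split.
  - by move=> s [sN s0]; split=> //=; lia.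
  - by move=> s s' _ _ [_ ->].
  - by move=> [r s] [/= E sN]; exists s; [split=> //; lia|congr pair; lia].
rewrite (fsbig_ord _ _ (fun s : nat =>
  (if s%:Z + d - c is Posz r then F (r, s) else 0)%R)).
rewrite -[RHS](@fsbig_widen _ _ _ _ D); first last.
- move=> s [/= sN nD]; case E : (s%:Z + d - c)%R => [r|//]; case: nD.
  by split=> //; rewrite E.
- by move=> s [].
apply: eq_fsbigr => s; rewrite inE => -[_ s0]; rewrite /g.
by case: (_ - c) s0 => [r|//].
Qed.

(** The power r = s - n - 1 - <a, b> of x determined by s may be negative, and then no term
    exists. *)
Definition exp_raisez a (k : int) : P :=
  if k is Posz r then exp_raise a r else 0.

HB.instance Definition _ (eps : 'rV[int]_l -> 'rV[int]_l -> K) a n :=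
  GRing.isLinear.Build K VQ VQ *:%R (vertex_mode M eps a n)
    (lin_ext_is_linear _).

Lemma vertex_modeE (eps : 'rV[int]_l -> 'rV[int]_l -> K) a n b p :
  exists N, forall N', (N <= N')%N ->
    vertex_mode M eps a n (vec b p) = eps a b *: \sum_(s < N')
      vec (a + b) (exp_raisez a (s%:Z + (- n - 1) - lattice_form M a b) *
                   exp_lower a s p).
Proof.
pose R N' p := eps a b *: \sum_(s < N')
  vec (a + b) (exp_raisez a (s%:Z + (- n - 1) - lattice_form M a b) *
               exp_lower a s p).
have lR N' : linear (R N').
  apply: linear_scaled_sum => s c u v.
  by rewrite exp_lower_linear mulrDr -scalerAr linearP.
apply: (eventually_eq_linear (f := fun p => vertex_mode M eps a n (vec b p))
  (g := R)) lR _ p => [c u v|m]; first by rewrite !linearP.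
(* For s > wt m the second exponential would give negative weight, so it contributes nothing. *)
exists (wt m).+1 => N' mN'.
rewrite vecE /vertex_mode lin_extE /= /R; congr (_ *: _).
rewrite (@fsbig_antidiagonal _ _ _ _ N') => [|[r s] /= N's].
  apply: eq_bigr => s _; case: (_ - lattice_form _ _ _) => [r|r] /=.
    exact: exp_coef_raise_lower.
  by rewrite mul0r linear0.
rewrite exp_coef_raise_lower exp_lower_mono_eq0 ?mulr0 ?linear0 //.
exact: leq_trans mN' N's.
Qed.

End LatticeVertexOperators.

(** * Stability and generation of the explicit span *)

Section PrincipalSpan.
Variables (K : fieldType) (l : nat) (M : 'M[int]_l).
Hypothesis charK : [pchar K] =i pred0.
Local Notation I := ('I_l * nat)%type.
Local Notation P := (polyalg I K).
Local Notation VQ := (VQ K l).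
Local Notation X i k := (@mono I K (ucm (i, k))).
Local Notation hgen := (hgen charK).
Implicit Types (a b : 'rV[int]_l) (p : P) (m : {cmonom I}).

Lemma newton_exp_raise a : newton (raise K a) (exp_raise K a).
Proof.
have := newton_mul_exp (fun n => n%:R^-1 *: raise K a n.-1) charK.
suff -> : (fun j => j.+1%:R *: (j.+1%:R^-1 *: raise K a j.+1.-1)) = raise K a by [].
by apply/funext => j; rewrite scalerA mulfV ?scale1r // ((pcharf0P K).1 charK).
Qed.

Lemma exp_raise_delta (i : 'I_l) : exp_raise K (delta_mx 0 i) =1 complete charK i.
Proof.
apply: (newton_unique charK (newton_exp_raise _)).
have -> : raise K (delta_mx 0 i) = (fun k => X i k); last exact: completeP.
apply/funext => k; rewrite /raise (bigD1 i) //= big1 ?addr0 => [|j /negbTE ji].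
  by rewrite mxE !eqxx scale1r.
by rewrite mxE ji andbF scale0r.
Qed.

Lemma filt_exp_raise a r : (forall j, 0 <= a 0 j) ->
  filt hgen a r%:Z (exp_raise K a r).
Proof.
move=> a_ge0; have [c [newt_c]] := filt_newton charK (fun j => absz (a 0 j)).
have -> : \sum_i delta_mx 0 i *+ absz (a 0 i) = a.
  rewrite [RHS]row_sum_delta; apply: eq_bigr => i _.
  by rewrite -scaler_nat; congr (_ *: _); rewrite natz gez0_abs.
suff /(newton_unique charK (newton_exp_raise a)) -> : newton (raise K a) c by [].
suff -> : raise K a = (fun k => \sum_i X i k *+ absz (a 0 i)) by [].
apply/funext => k; apply: eq_bigr => i _.
by rewrite -[in LHS](gez0_abs (a_ge0 i)) -pmulrn scaler_nat.
Qed.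

(** By [derivation_newton], a(k+1) maps h_(i,r) to a multiple of h_(i,r-k-1) or to 0, which respects
    the colour degree and lowers the weight by k + 1. *)
Lemma filt_exp_lower a b e s p :
  filt hgen b e p -> filt hgen b (e - s%:Z) (exp_lower M a s p).
Proof.
apply: exp_lower_filt => k [i j] /=.
rewrite /hgen /= (derivation_newton charK (lower_derivation K M a k)
  (completeP charK i) (fun j => lowerX K M a k i j)).
case: ltnP => kj; last by case: (filt_lin_closed hgen (delta_mx 0 i) (j.+1%:Z - k.+1%:Z)).
apply: lin_closedZ; first exact: filt_lin_closed.
by rewrite subzn //; apply: filt_complete.
Qed.

(** The explicit description of W(Lambda_0), justified by [principal_subspaceP]. The condition
    [bounded b m] already forces the coordinates of b to be nonnegative. *)
Definition principal : VQ -> Prop :=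
  span_of (fun v => exists b m, v = vec b (monom_eval hgen m) /\ bounded b m).

Lemma principal_lin_closed : lin_closed principal.
Proof. exact: span_lin_closed. Qed.

Lemma filt_principal b e p : filt hgen b e p -> principal (vec b p).
Proof.
move=> fp; apply: (span_sub fp (S := fun p => principal (vec b p))).
  exact: lin_closed_preim (linear_vec b) principal_lin_closed.
by move=> _ [m [-> mb _]]; apply: span_gen; exists b, m.
Qed.

Lemma vec_vacuum : vec 0 (1 : P) = vacuum K l.
Proof. by rewrite -mono1 vecE. Qed.

Lemma principal_vacuum : principal (vacuum K l).
Proof. by rewrite -vec_vacuum; apply: filt_principal (filt1 _). Qed.

Variable eps : 'rV[int]_l -> 'rV[int]_l -> K.

Lemma principal_vertex a n v : (forall j, 0 <= a 0 j) ->
  principal v -> principal (vertex_mode M eps a n v).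
Proof.
move=> a_ge0 Uv; apply: (span_sub Uv (S := fun v => principal (vertex_mode M eps a n v))).
  by apply: lin_closed_preim principal_lin_closed; apply: lin_ext_is_linear.
move=> _ [b [m [-> mb]]]; have [N /(_ N (leqnn N)) ->] :=
  vertex_modeE M eps a n b (monom_eval hgen m).
apply: lin_closedZ; first exact: principal_lin_closed.
apply: lin_closed_sum => [|s _]; first exact: principal_lin_closed.
have fs := filt_exp_lower a s (filt_mono hgen mb).
case: (_ - lattice_form M a b) => [r|r] /=.
  exact: filt_principal (filtM (filt_exp_raise r a_ge0) fs).
by rewrite mul0r linear0; case: principal_lin_closed.
Qed.

Hypothesis eps_neq0 : forall a b, eps a b != 0.

(* The term of lowest index in x_(alpha_i)(n) (p (x) e^b') is h_r p (x) e^b, up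
   to a unit; the other terms involve exp_lower images of p, of lower weight. *)
Lemma principal_sub (W : VQ -> Prop) v : lin_closed W -> W (vacuum K l) ->
  (forall i n v, W v -> W (vertex_mode M eps (delta_mx 0 i) n v)) ->
  principal v -> W v.
Proof.
move=> Wcl W0 WV Uv; apply: (span_sub Uv Wcl) => _ [b [m [-> mb]]] {v Uv}.
(* The outer induction is on \sum_j |b_j|; one simple root is removed from b at each stage. *)
have [N] : exists N, (\sum_j absz (b 0%R j))%N = N by eexists.
elim: N b m mb => [|N IHN] b m mb bN.
  have b0 : b = 0.
    apply/rowP => j; move/eqP: bN; rewrite sum_nat_eq0 => /forallP/(_ j).
    by rewrite mxE /= absz_eq0 => /eqP.
  have -> : m = onecm _.
    apply/eqP/cmP => x; rewrite onecmE; apply: contraTeq (mb x.1) => mx.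
    rewrite b0 [leRHS]mxE -ltNge mxE.
    rewrite (@cmonom_factor _ m x) ?lt0n // wdegM wdegU eqxx; lia.
  by rewrite b0 /monom_eval mdom1 big_seq_fset0 vec_vacuum.
have b_ge0 j : 0 <= b 0 j by apply: le_trans (mb j); apply: mdegs_ge0.
have [i bi] : exists i, 0 < b 0 i.
  apply/not_existsP => b_le0; move: bN; rewrite big1 // => j _.
  by have := b_ge0 j; have /negP := b_le0 j; lia.
pose b' := b - delta_mx 0 i.
have bE : delta_mx 0 i + b' = b by rewrite addrC subrK.
have b'N : (\sum_j absz (b' 0%R j))%N = N.
  apply: succn_inj; rewrite -bN (bigD1 i) //= [in RHS](bigD1 i) //= -addSn.
  congr (_ + _)%N; first by rewrite !mxE !eqxx /=; lia.
  by apply: eq_bigr => j /negbTE ji; rewrite !mxE ji andbF /= subr0.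
have Wb' e p : filt hgen b' e p -> W (vec b' p).
  move=> fp; apply: (span_sub fp (S := fun p => W (vec b' p))).
    exact: lin_closed_preim (linear_vec b') Wcl.
  by move=> _ [m' [-> m'b' _]]; apply: IHN.
(* The inner induction is on the weight e of p, for all r at once. *)
have Wb (e : nat) p r : filt hgen b' e%:Z p ->
    W (vec b (complete charK i r * p)).
  elim/ltn_ind: e p r => e IHe p r fp.
  (* With this mode, the term of index s carries h_(i,r+s), so the term s = 0 is the wanted one. *)
  pose n := - 1 - r%:Z - lattice_form M (delta_mx 0 i) b'.
  have [N' /(_ N'.+1 (leqnSn N'))] := vertex_modeE M eps (delta_mx 0 i) n b' p.
  rewrite bE; move: (WV i n _ (Wb' _ _ fp)) => + E; rewrite {}E.
  move/(lin_closedZ (eps (delta_mx 0 i) b')^-1 Wcl).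
  rewrite scalerA mulVf ?eps_neq0 // scale1r big_ord_recl /= => Wsum.
  have idx s : s%:Z + (- n - 1) - lattice_form M (delta_mx 0 i) b' = (r + s)%N%:Z.
    by rewrite /n PoszD; lia.
  move: Wsum; rewrite idx addn0 /= exp_raise_delta /exp_lower gexp0.
  set t := (Z in vec b _ + Z) => Wsum.
  (* The tail consists of h_(i,r+s+1) times images of p of weight e - s - 1: the inner induction
     applies when this weight is nonnegative, and otherwise the image is 0. *)
  suff Wt : W t.
    by rewrite -[vec _ _](addrK t); apply: lin_closedD => //; apply: lin_closedN.
  apply: lin_closed_sum => // s _; rewrite /bump /= add1n idx /= exp_raise_delta.
  have fs := filt_exp_lower (delta_mx 0 i) s.+1 fp.
  have [se|es] := leqP s.+1 e.
    by apply: (IHe (e - s.+1)%N); [lia|rewrite -subzn].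
  rewrite (_ : gexp _ _ p = 0); last by apply: filt_neg fs; lia.
  by rewrite mulr0 linear0; case: Wcl.
(* If colour i does not occur in m, the factor h_(i,0) = 1 is inserted; otherwise some factor
   h_(i,k+1) is split off. Either way the cofactor is bounded by b'. *)
have [mi0|mi_neq0] := eqVneq (mdegs m 0 i) 0.
  rewrite -[monom_eval _ _]mul1r; have [<- _] := completeP charK i.
  apply: Wb; apply: filt_mono => j; rewrite !mxE eqxx /=.
  case: (eqVneq j i) => [->|_]; last by have := mb j; rewrite mxE subr0.
  by move: mi0; rewrite mxE /= => ->; lia.
have [] := @wdeg_gt0 _ (fun x : I => (x.1 == i) : nat) m.
  by rewrite lt0n; apply: contraNneq mi_neq0 => w0; rewrite mxE w0.
move=> [i' k] mx /=; rewrite lt0b => /eqP i'i; move: mx; rewrite {}i'i => mx.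
move: mb; rewrite (cmonom_factor mx); set m' := divcm _ _ => mb.
rewrite monom_evalM -mevalE mevalX; apply: (Wb _ _ k.+1).
apply: filt_mono => j; rewrite -(lerD2l ((delta_mx 0 i : 'rV[int]_l) 0 j)).
have := mb j; rewrite mdegsM mdegsU mxE => /le_trans; apply.
by rewrite -[in leLHS]bE [leLHS]mxE.
Qed.

End PrincipalSpan.

(** * Counting coloured partitions *)

Section PartitionCount.
Variable l : nat.
Local Notation I := ('I_l * nat)%type.
Implicit Types (n b : 'rV[int]_l) (e : int) (m : {cmonom I}) (i : 'I_l).

(** A monomial is read as a coloured partition of e, the variable (j, k) being a part k + 1 of
    colour j; n bounds the number of parts of each colour. *)
Definition slice n e m : Prop := bounded n m /\ (wt m)%:Z = e.

Definition enumerates (T : eqType) (s : seq T) (A : T -> Prop) : Prop :=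
  uniq s /\ forall x, x \in s <-> A x.

Definition next i (x : I) : I := if x.1 == i then (x.1, x.2.+1) else x.

Lemma next_inj i : injective (next i).
Proof.
move=> [j k] [j' k']; rewrite /next /=.
by do 2![case: eqP => ?] => -[] => *; subst.
Qed.

Lemma next_neq i x : next i x == (i, 0%N) = false.
Proof.
apply/negP => /eqP; rewrite /next; case: eqP => [_ []//|xi].
by move=> E; apply: xi; rewrite E.
Qed.

(** Image of the multiset of parts under [next i]: the exponent of y collects the exponents of its
    preimages. Every part of colour i grows by 1. *)
Definition raise_parts i m : {cmonom I} :=
  [cmonom wdeg (fun x => (next i x == y) : nat) m
     | y in [fset next i x | x in finsupp m]%fset]%M.

Lemma raise_partsE i m y :
  raise_parts i m y = wdeg (fun x => (next i x == y) : nat) m.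
Proof.
rewrite cmE fsfun_fun; case: ifPn => // ym; apply/esym/eqP.
rewrite -leqn0 leqNgt; apply/negP => /wdeg_gt0[x mx]; rewrite lt0b => /eqP xy.
move/negP: ym; apply; apply/imfsetP; exists x => //=.
by rewrite -cmE_neq0 -lt0n.
Qed.

Lemma raise_parts_next i m x : raise_parts i m (next i x) = m x.
Proof.
rewrite raise_partsE -[RHS]wdeg_delta; congr (wdeg _ m).
by apply/funext => y; rewrite (inj_eq (@next_inj i)).
Qed.

Lemma raise_parts1 i : raise_parts i (onecm _) = onecm _.
Proof. by apply/eqP/cmP => y; rewrite raise_partsE wdeg1 onecmE. Qed.

Lemma raise_partsU i x : raise_parts i (ucm x) = ucm (next i x).
Proof. by apply/eqP/cmP => y; rewrite raise_partsE wdegU ucmE. Qed.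

Lemma raise_partsM i m1 m2 : raise_parts i (mulcm m1 m2) =
  mulcm (raise_parts i m1) (raise_parts i m2).
Proof. by apply/eqP/cmP => y; rewrite mulcmE !raise_partsE wdegM. Qed.

Lemma mdegs_raise_parts i m : mdegs (raise_parts i m) = mdegs m.
Proof.
elim/cmonom_ind: m => [|x m IHm]; first by rewrite raise_parts1.
rewrite raise_partsM raise_partsU !mdegsM IHm !mdegsU /next.
by case: ifP.
Qed.

Lemma wtU (x : I) : wt (ucm x) = x.2.+1.
Proof. exact: wdegU. Qed.

Lemma wt1 : wt (onecm I) = 0%N.
Proof. exact: wdeg1. Qed.

Lemma wt_raise_parts i m : (wt (raise_parts i m))%:Z = (wt m)%:Z + mdegs m 0 i.
Proof.
elim/cmonom_ind: m => [|x m IHm].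
  by rewrite raise_parts1 wt1 mdegs1 mxE.
rewrite raise_partsM raise_partsU !wtM !PoszD IHm mdegsM mdegsU !wtU /next.
rewrite [in RHS]mxE [X in _ = _ + (X + _)]mxE eqxx /= [x.1 == i]eq_sym.
by case: (eqVneq i x.1) => _ /=; lia.
Qed.

Definition ones i a : {cmonom I} := iter a (mulcm (ucm (i, 0%N))) (onecm _).

Lemma wt_ones i a : wt (ones i a) = a.
Proof. by elim: a => [|a IHa]; rewrite ?wt1 //= wtM wtU IHa. Qed.

Lemma mdegs_ones i a : mdegs (ones i a) = delta_mx 0 i *+ a.
Proof.
elim: a => [|a IHa]; first by rewrite mdegs1.
by rewrite mulrS -IHa /= mdegsM mdegsU.
Qed.

Lemma ones_next i a x : ones i a (next i x) = 0%N.
Proof.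
by elim: a => [|a IHa] /=; rewrite ?onecmE // mulcmE ucmE IHa eq_sym next_neq.
Qed.

(** Only the parts of colour i and size 1 lie outside the image of [next i]; they are gathered in
    [ones i a]. *)
Lemma raise_parts_surj i m :
  exists m' a, m = mulcm (raise_parts i m') (ones i a).
Proof.
elim/cmonom_ind: m => [|[j k] m [m' [a ->]]].
  by exists (onecm _), 0%N; rewrite raise_parts1 mulcm0.
have [[-> ->]|[x ->]] : (j = i /\ k = 0%N) \/ exists x, (j, k) = next i x.
- rewrite /next; case: (eqVneq j i) => [->|ji]; last first.
    by right; exists (j, k) => /=; rewrite (negbTE ji).
  case: k => [|k]; first by left.
  by right; exists (i, k); rewrite /= eqxx.
- by exists m', a.+1; rewrite /= !mulcmA [mulcm (ucm _) _]mulcmC.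
- by exists (mulcm (ucm x) m'), a; rewrite raise_partsM raise_partsU mulcmA.
Qed.

(* Adding 1 to each of the n_i parts (some of which are 0) of colour i. *)
Definition raise_all n i m : {cmonom I} :=
  mulcm (raise_parts i m) (ones i (absz (n 0 i - mdegs m 0 i)%R)).

(** [ones] vanishes on the image of [next i], so the exponents of m are read off there. *)
Lemma raise_all_inj n i : injective (raise_all n i).
Proof.
move=> m1 m2 /eqP/cmP E; apply/eqP/cmP => x; have := E (next i x).
by rewrite !mulcmE !raise_parts_next !ones_next !addn0.
Qed.

Lemma slice_raise_all n i e m : slice n (e - n 0 i) m ->
  slice n e (raise_all n i m) /\ mdegs (raise_all n i m) 0 i = n 0 i.
Proof.
move=> [mb we]; have mi := mb i.
have deg j : mdegs (raise_all n i m) 0 j =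
    mdegs m 0 j + (if j == i then n 0 i - mdegs m 0 i else 0).
  rewrite mdegsM mdegs_raise_parts mdegs_ones [LHS]mxE; congr (_ + _).
  rewrite mulmxnE mxE eqxx /=; case: (j == i); last by rewrite mul0rn.
  by rewrite /= natz; lia.
split; last by rewrite deg eqxx; lia.
split=> [j|]; first by rewrite deg; case: eqP => [->|_]; [lia|rewrite addr0; apply: mb].
by rewrite wtM wt_ones PoszD wt_raise_parts; lia.
Qed.

Lemma raise_all_surj n i e m : slice n e m -> mdegs m 0 i = n 0 i ->
  exists2 m', slice n (e - n 0 i) m' & m = raise_all n i m'.
Proof.
move=> [mb we] mi; have [m' [a mE]] := raise_parts_surj i m.
have deg j : mdegs m 0 j = mdegs m' 0 j + (if j == i then a%:Z else 0).
  rewrite mE mdegsM mdegs_raise_parts mdegs_ones [LHS]mxE; congr (_ + _).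
  rewrite mulmxnE mxE eqxx /=; case: (j == i); last by rewrite mul0rn.
  by rewrite /= natz; lia.
(* Having exactly n_i parts of colour i forces the number of ones that [raise_all] adds. *)
have aE : n 0 i - mdegs m' 0 i = a by rewrite -mi deg eqxx; lia.
exists m'; last by rewrite /raise_all aE.
split=> [j|]; last first.
  by move: we; rewrite mE wtM wt_ones PoszD wt_raise_parts; lia.
by apply: le_trans (mb j); rewrite deg; case: ifP => _; lia.
Qed.

(** The combinatorial form of the recursion: partitions with fewer than n_i parts of colour i come
    from s1, those with exactly n_i from s2 through [raise_all]. *)
Lemma enumerates_slice n i e s1 s2 :
  enumerates s1 (slice (n - delta_mx 0 i) e) ->
  enumerates s2 (slice n (e - n 0 i)) ->
  enumerates (s1 ++ map (raise_all n i) s2) (slice n e).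
Proof.
move=> [u1 in1] [u2 in2].
have sliceP m : slice (n - delta_mx 0 i) e m <->
    slice n e m /\ mdegs m 0 i < n 0 i.
  have nE j : (n - delta_mx 0 i) 0 j = n 0 j - (if j == i then 1 else 0).
    by rewrite !mxE eqxx /=; case: ifP.
  split=> [[mb we]|[[mb we] mi]].
    split; last by have := mb i; rewrite nE eqxx; lia.
    by split=> // j; have := mb j; rewrite nE; case: ifP => _; lia.
  split=> // j; have := mb j; rewrite nE.
  by case: (eqVneq j i) => [->|_]; lia.
split=> [|m].
  rewrite cat_uniq u1 (map_inj_uniq (@raise_all_inj n i)) u2 andbT /=.
  apply/hasPn => _ /mapP[m /in2 m2 ->]; apply/negP => /in1/sliceP[_].
  by have [_ ->] := slice_raise_all m2; rewrite ltxx.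
rewrite mem_cat; split=> [/orP[/in1/sliceP[]//|/mapP[m' /in2 m'2 ->]]|ms].
  by have [] := slice_raise_all m'2.
have [mi|mi] := ltP (mdegs m 0 i) (n 0 i).
  by apply/orP; left; apply/in1/sliceP.
have mi' : mdegs m 0 i = n 0 i by apply: le_anti; rewrite mi (ms.1 i).
have [m' /in2 m'2 ->] := raise_all_surj ms mi'.
by apply/orP; right; apply: map_f.
Qed.

Lemma enumerates_nil (T : eqType) (A : T -> Prop) :
  (forall x, ~ A x) -> enumerates [::] A.
Proof. by move=> nA; split=> // x; split=> // /nA. Qed.

(** The recursion of [enumerates_slice] terminates: for n_i > 0 its first branch lowers n_i and its
    second lowers e, inside the measure \sum_j |n_j| + |e|. *)
Lemma enumerates_ex n e : exists s, enumerates s (slice n e).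
Proof.
have [N] := ubnP (\sum_j absz (n 0%R j) + absz e)%N.
elim: N n e => // N IHN n e; rewrite ltnS => leN.
have [[j nj]|n_ge0] := pselect (exists j, n 0 j < 0).
  exists [::]; apply: enumerates_nil => m [/(_ j) mb _].
  by have := mdegs_ge0 m j; lia.
have [e_lt0|e_ge0] := ltP e 0.
  by exists [::]; apply: enumerates_nil => m [_]; lia.
have [[i ni]|n_le0] := pselect (exists i, 0 < n 0 i); last first.
  have m1 m : bounded n m -> m = onecm _.
    move=> mb; apply/eqP/cmP => x; rewrite onecmE; apply: contraTeq (mb x.1) => mx.
    rewrite -ltNge (@cmonom_factor _ m x) ?lt0n // mdegsM mdegsU [ltRHS]mxE.
    have -> : (delta_mx 0 x.1 : 'rV[int]_l) 0 x.1 = 1 by rewrite mxE !eqxx.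
    have := mdegs_ge0 (divcm m (ucm x)) x.1.
    have : n 0 x.1 <= 0 by rewrite leNgt; apply/negP => nx; apply: n_le0; exists x.1.
    by move=> nx dx; apply: le_lt_trans nx _; rewrite ltr_wpDr.
  have b1 : bounded n (onecm _).
    move=> j; rewrite mdegs1 mxE leNgt; apply/negP => nj.
    by apply: n_ge0; exists j.
  have [e0|e0] := eqVneq e 0.
    exists [:: onecm _]; split=> // m; rewrite inE; split=> [/eqP->|[/m1-> _]//].
    by split=> //; rewrite wt1 e0.
  exists [::]; apply: enumerates_nil => m [/m1 -> we].
  by move: e0; rewrite -we wt1 eqxx.
have [s1 s1E] : exists s, enumerates s (slice (n - delta_mx 0 i) e).
  apply: IHN; apply: leq_trans leN; rewrite -addSn leq_add2r.
  rewrite (bigD1 i) //= [leqRHS](bigD1 i) //= -addSn leq_add //.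
    by rewrite !mxE !eqxx /=; lia.
  by apply: leq_sum => j /negbTE ji; rewrite !mxE ji andbF /= subr0.
(* For e < n_i the slice is empty; this case is separate because |e - n_i| need not be smaller than
   |e|. *)
have [s2 s2E] : exists s, enumerates s (slice n (e - n 0 i)).
  have [e_lt|e_ge] := ltP e (n 0 i).
    by exists [::]; apply: enumerates_nil => m [_]; lia.
  by apply: IHN; apply: leq_trans leN; rewrite -addnS leq_add2l; lia.
by exists (s1 ++ map (raise_all n i) s2); apply: enumerates_slice.
Qed.

End PartitionCount.

(** * Uniqueness and computation of dimensions *)

Section Dimension.
Variables (K : fieldType) (V : lmodType K).
Implicit Type S : set V.

(** Expressing each basis in the other gives matrices C and C' with C C' = 1, by freeness of b,
    whence d <= d'. *)
Lemma has_dim_le S d d' : has_dim S d -> has_dim S d' -> (d <= d')%N.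
Proof.
move=> [b [bS b_free b_gen]] [b' [b'S b'_free b'_gen]].
have [C CE] := choice (fun i => b'_gen _ (bS i)).
have [C' C'E] := choice (fun i => b_gen _ (b'S i)).
apply: (@mulmx1_min _ _ _ (\matrix_(i, j) C i j) (\matrix_(j, i) C' j i)).
apply/matrixP => i k; apply/eqP; rewrite -subr_eq0; apply/eqP.
set A := _ *m _; pose c k := A i k - (1%:M : 'M[K]_d) i k.
apply: (b_free c); rewrite /c; under eq_bigr => k' _ do rewrite scalerBl.
rewrite sumrB; apply/eqP; rewrite subr_eq0; apply/eqP.
transitivity (b i).
  rewrite [RHS]CE; under eq_bigr => k' _ do rewrite mxE scaler_suml.
  rewrite exchange_big; apply: eq_bigr => j _ /=.
  rewrite (C'E j) scaler_sumr; apply: eq_bigr => k' _.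
  by rewrite !mxE scalerA.
rewrite (bigD1 i) //= big1 => [|k' ki].
  by rewrite mxE eqxx scale1r addr0.
by rewrite mxE eq_sym (negbTE ki) scale0r.
Qed.

Lemma dimensionE S d : has_dim S d -> dimension S = d.
Proof.
move=> Sd; have Sd' : has_dim S (dimension S) by apply: (xgetPex _ (ex_intro _ d Sd)).
by apply/eqP; rewrite eqn_leq !(has_dim_le Sd, has_dim_le Sd').
Qed.

Lemma has_dim_seq (T : eqType) (F : T -> V) (s : seq T) S : uniq s ->
  (forall c : T -> K, \sum_(x <- s) c x *: F x = 0 ->
     forall x, x \in s -> c x = 0) ->
  (forall x, x \in s -> S (F x)) ->
  (forall v, S v -> exists c : T -> K, v = \sum_(x <- s) c x *: F x) ->
  has_dim S (size s).
Proof.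
move=> s_uniq s_free sS s_gen; case: s s_uniq s_free sS s_gen => [|x0 s'].
  move=> _ _ _ gen; exists (fun _ => 0); split=> [[]//|c _ []//|v /gen[c ->]].
  by exists (fun _ => 0); rewrite big_nil big_ord0.
set s := x0 :: s' => s_uniq s_free sS s_gen.
have sumE (c : T -> K) : \sum_(x <- s) c x *: F x =
    \sum_(i < size s) c (nth x0 s i) *: F (nth x0 s i).
  by rewrite (big_nth x0) big_mkord.
exists (fun i => F (nth x0 s i)); split=> [i|c c0 i|v /s_gen[c ->]].
- by apply/sS/mem_nth.
(* Coefficients indexed by positions become a function on T, extended by 0 outside s; this uses that
   s is duplicate-free. *)
- pose c' x := if insub (index x s) is Some j then c j else 0.
  have c'E (j : 'I_(size s)) : c' (nth x0 s j) = c j.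
    rewrite /c' index_uniq // insubT /= ?ltn_ord // => jlt.
    by congr c; apply: val_inj.
  rewrite -c'E; apply: s_free; last exact: mem_nth.
  by rewrite sumE -[RHS]c0; apply: eq_bigr => j _; rewrite c'E.
- by exists (fun i => c (nth x0 s i)); rewrite sumE.
Qed.

End Dimension.

(** * Linear combinations of a finite family *)

Section Combinations.
Variables (K : fieldType) (V : lmodType K) (T : eqType).
Implicit Types (s : seq T) (F : T -> V).

Definition comb s F v : Prop := exists c : T -> K, v = \sum_(x <- s) c x *: F x.

Lemma lin_closed_comb s F : lin_closed (comb s F).
Proof.
split=> [|a v w [c ->] [d ->]].
  by exists (fun=> 0); rewrite big1 // => x _; rewrite scale0r.
exists (fun x => a * c x + d x); rewrite scaler_sumr -big_split.
by apply: eq_bigr => x _; rewrite scalerDl scalerA.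
Qed.

Lemma comb_mem s F x : uniq s -> x \in s -> comb s F (F x).
Proof.
move=> us xs; exists (fun y => (y == x)%:R); rewrite (bigD1_seq x) //=.
rewrite eqxx scale1r big1 ?addr0 // => y /negbTE ->.
by rewrite scale0r.
Qed.

End Combinations.

(** * Dimensions of the joint weight spaces *)

Section WeightSpaces.
Variables (K : fieldType) (l : nat) (M : 'M[int]_l).
Hypothesis charK : [pchar K] =i pred0.
Local Notation I := ('I_l * nat)%type.
Local Notation P := (polyalg I K).
Local Notation VQ := (VQ K l).
Local Notation hgen := (hgen charK).
Implicit Types (n b : 'rV[int]_l) (p q : P) (m : {cmonom I}).

Lemma intr_inj_char0 : injective (fun z : int => z%:~R : K).
Proof.
move=> z t /eqP; rewrite -subr_eq0 -intrB => zt; apply/eqP; rewrite -subr_eq0.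
move: (z - t) zt => [k|k].
  by rewrite -pmulrn ((pcharf0P K).1 charK).
by rewrite NegzE rmorphN oppr_eq0 /= -pmulrn ((pcharf0P K).1 charK).
Qed.

(** The weight grading in the original variables, where [L0] is diagonal; [homogeneous_hgen] shows
    that the generators h_(i,r) respect it. *)
Definition homogeneous (e : nat) : P -> Prop :=
  span_of (fun v => exists2 m, v = mono K m & wt m = e).

Lemma homogeneous_lin_closed e : lin_closed (homogeneous e).
Proof. exact: span_lin_closed. Qed.

Lemma homogeneous_mono m : homogeneous (wt m) (mono K m).
Proof. by apply: span_gen; exists m. Qed.

Lemma homogeneousM e1 e2 p q : homogeneous e1 p -> homogeneous e2 q ->
  homogeneous (e1 + e2) (p * q).
Proof.
move=> hp hq; apply: (span_sub hp (S := fun p => homogeneous (e1 + e2) (p * q))).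
  apply: (@lin_closed_preim _ _ _ (fun p => p * q)); last exact: homogeneous_lin_closed.
  by move=> c u v; rewrite mulrDl scalerAl.
move=> _ [m1 -> <-].
apply: (span_sub hq (S := fun q => homogeneous (wt m1 + e2) (mono K m1 * q))).
  apply: (@lin_closed_preim _ _ _ (fun q => _ * q)); last exact: homogeneous_lin_closed.
  by move=> c u v; rewrite mulrDr scalerAr.
by move=> _ [m2 -> <-]; rewrite -monoM -wtM; apply: homogeneous_mono.
Qed.

Lemma homogeneous_complete i r : homogeneous r (complete charK i r).
Proof.
have [c0 cS] := completeP charK i.
elim/ltn_ind: r => -[_|r IHr].
  by rewrite c0 -mono1 -(@wt1 l); apply: homogeneous_mono.
have r_neq0 : r.+1%:R != 0 :> K by rewrite ((pcharf0P K).1 charK).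
rewrite -[complete _ _ _]scale1r -(mulVf r_neq0) -scalerA cS.
apply: lin_closedZ; first exact: homogeneous_lin_closed.
apply: lin_closed_sum => [|j _]; first exact: homogeneous_lin_closed.
have rE : (wt (ucm (i, j : nat)) + (r - j))%N = r.+1.
  by rewrite wtU /=; have := ltn_ord j; lia.
rewrite -[Z in homogeneous Z _]rE.
apply: homogeneousM; first exact: homogeneous_mono.
by apply: IHr; rewrite ltnS leq_subr.
Qed.

Lemma homogeneous_hgen m : homogeneous (wt m) (monom_eval hgen m).
Proof.
elim/cmonom_ind: m => [|x m IHm].
  by rewrite /monom_eval mdom1 big_seq_fset0 -mono1; apply: homogeneous_mono.
rewrite monom_evalM wtM -mevalE mevalX; apply: homogeneousM => //.
by rewrite wtU; apply: homogeneous_complete.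
Qed.

(** A common form for [L0], the operators lambda_j(0) and the projections onto weight spaces. *)
Definition diag (f : VQbasis l -> K) : VQ -> VQ :=
  lin_ext (fun u => f u *: VQvec K u).

Lemma diag_vec f b e p c : (forall m, wt m = e -> f (m, b) = c) ->
  homogeneous e p -> diag f (vec b p) = c *: vec b p.
Proof.
move=> fc hp; have ld : linear (diag f) by apply: lin_ext_is_linear.
apply: (span_sub hp (S := fun p => diag f (vec b p) = c *: vec b p)).
  split=> [|a u v Eu Ev]; last first.
    by rewrite linearP ld Eu Ev scalerDr !scalerA mulrC.
  by have [D ->] := linear_bundle ld; rewrite !linear0.
by move=> _ [m -> /fc <-]; rewrite vecE /diag lin_extE.
Qed.

Lemma mcoeff_diag f (w : VQ) u : mcoeff u (diag f w) = f u * mcoeff u w.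
Proof.
move: w; apply: (@eq_linear_malg _ _ K^o (fun w => mcoeff u (diag f w))
  (fun w => f u * mcoeff u w)).
- move=> c v w; rewrite /diag [lin_ext _ _](lin_ext_is_linear _ c v w).
  by rewrite mcoeffD mcoeffZ.
- by move=> c v w; rewrite mcoeffD mcoeffZ mulrDr mulrCA.
move=> v; rewrite [diag _ _](lin_extE _ v) mcoeffZ /VQvec mcoeffU.
by case: eqP => [->|_]; rewrite ?mulr0.
Qed.

Lemma diag_eigen f (w : VQ) c u :
  diag f w = c *: w -> u \in msupp w -> f u = c.
Proof.
move=> dw; rewrite -mcoeff_neq0 => wu; apply: (mulIf wu).
by rewrite -mcoeff_diag dw mcoeffZ.
Qed.

Definition unvec : VQ -> P := mlin (fun u : VQbasis l => mono K u.1).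

Lemma unvecK b p : unvec (vec b p) = p.
Proof.
have lu : linear unvec by apply: mlin_is_linear.
move: p; apply: eq_linear_poly => [c p q|c p q //|m].
  by rewrite linearP lu.
by rewrite vecE; apply: mlinU.
Qed.

Lemma mono_free (s : seq {cmonom I}) (c : {cmonom I} -> K) : uniq s ->
  \sum_(m <- s) c m *: mono K m = 0 -> forall m, m \in s -> c m = 0.
Proof.
move=> us c0 m ms; have [coef coefE] : exists coef : {linear P -> K^o},
    forall m', coef (mono K m') = (m' == m)%:R.
  by exists (plin (fun m' => (m' == m)%:R : K^o)) => m'; apply: plinE.
have /eqP : coef (\sum_(m <- s) c m *: mono K m) = 0 by rewrite c0 linear0.
rewrite linear_sum /= (bigD1_seq m) //= big1 => [|m' /negbTE m'm].
  by rewrite addr0 linearZ /= coefE eqxx [_ *: _]mulr1 => /eqP.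
by rewrite linearZ /= coefE m'm scaler0.
Qed.

Lemma wt_sum m : (\sum_(x <- finsupp m) (m x * x.2.+1)%:R : K) = (wt m)%:R.
Proof. by rewrite /wt /wdeg natr_sum. Qed.

Lemma L0_diag : L0 M =1 diag (fun u : VQbasis l =>
  (wt u.1)%:R + (lattice_form M u.2 u.2)%:~R / 2).
Proof.
move=> w; rewrite /L0 /diag /lin_ext; apply: eq_bigr => u _.
by rewrite wt_sum.
Qed.

Lemma weight_has_dim n (d k : int) s : lattice_form M n n = k + k ->
  enumerates s (slice n (d - k)) ->
  has_dim [set w : VQ | [/\ principal charK w,
      forall j, diag (fun u => (u.2 0 j)%:~R) w = (n 0 j)%:~R *: w &
      L0 M w = d%:~R *: w]] (size s).
Proof.
move=> nk [us sE]; have two_neq0 : 2 != 0 :> K by rewrite ((pcharf0P K).1 charK).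
have halfE : (lattice_form M n n)%:~R / 2 = k%:~R :> K.
  by apply: (mulIf two_neq0); rewrite divfK // nk rmorphD /= mulr_natr mulr2n.
apply: (@has_dim_seq _ _ _ (fun m => vec n (monom_eval hgen m))) => //.
(* Independence is pulled back to distinct monomials in the variables, since [meval hgen] is
   injective and [unvec] is a left inverse of [vec n]. *)
- move=> c c0; apply: (mono_free us); apply: (@meval_hgen_inj K l charK).
  rewrite linear0 -[LHS](unvecK n) -[RHS](unvecK n); congr unvec.
  rewrite linear0 -c0 !linear_sum; apply: eq_bigr => m _.
  by rewrite !linearZ /= mevalE.
- move=> m /sE[mb we]; have hm := homogeneous_hgen m; split.
  + by apply: span_gen; exists n, m.
  + by move=> j; apply: diag_vec hm.
  + rewrite L0_diag; apply: diag_vec hm => m' /= ->; rewrite halfE.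
    by rewrite -[wt m]/(absz (wt m)) pmulrn -rmorphD /= we subrK.
move=> w [Pw wn wd].
(* The projection onto lattice degree n and weight d - k: it fixes the joint eigenvector w, so
   applying it to a combination representing w isolates the relevant terms. *)
pose f (u : VQbasis l) : K := ((u.2 == n) && ((wt u.1)%:Z == d - k))%:R.
have wE : diag f w = w.
  apply/malgP => u; apply: etrans (mcoeff_diag f w u) _.
  have [->|wu] := eqVneq (mcoeff u w) 0; first by rewrite mulr0.
  have uw : u \in msupp w by rewrite -mcoeff_neq0.
  have un : u.2 = n.
    by apply/rowP => j; apply: intr_inj_char0; apply: diag_eigen (wn j) uw.
  have := diag_eigen (etrans (esym (L0_diag w)) wd) uw.
  rewrite un halfE pmulrn -rmorphD /= => /intr_inj_char0 dE.
  by rewrite /f un -dE addrK !eqxx mul1r.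
have ld : linear (diag f) by apply: lin_ext_is_linear.
rewrite -wE; apply: (span_sub Pw (S := fun w => comb s
  (fun m => vec n (monom_eval hgen m)) (diag f w))).
  exact: lin_closed_preim ld (lin_closed_comb _ _).
move=> _ [b [m [-> mb]]].
(* Each spanning vector is homogeneous, so the projection fixes it or kills it. *)
rewrite (@diag_vec f b (wt m) _ ((b == n) && ((wt m)%:Z == d - k))%:R) => [|m' /= e|]; last first.
- exact: homogeneous_hgen.
- by rewrite /f /= e.
have [/andP[/eqP bn /eqP we]|_] := boolP (_ && _); last first.
  by rewrite scale0r; case: (lin_closed_comb s (fun m => vec n (monom_eval hgen m))).
have ms : m \in s by apply/sE; split=> //; rewrite -bn.
by rewrite scale1r bn; apply: (comb_mem (fun m => vec n (monom_eval hgen m))).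
Qed.

End WeightSpaces.

(** * Agreement of the two forms of linear span *)

Section PrincipalSubspace.
Variables (K : fieldType) (V : lmodType K).
Implicit Types (S : set V).

Lemma lin_spanE S : lin_span S = span_of S :> (V -> Prop).
Proof.
apply/funext => v; apply/propext; split=> [[n [c [w [Sw ->]]]]|].
  apply: lin_closed_sum => [|i _]; first exact: span_lin_closed.
  by apply: lin_closedZ; [apply: span_lin_closed|apply: span_gen].
elim=> [|c u w Su _ [n [d [x [Sx ->]]]]].
  by exists 0%N, (fun=> 0), (fun=> 0); split=> [[]//|]; rewrite big_ord0.
exists n.+1, (fun i => if unlift ord0 i is Some j then d j else c),
  (fun i => if unlift ord0 i is Some j then x j else u).
split=> [i|]; first by case: unliftP.
rewrite big_ord_recl unlift_none; congr (_ + _).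
by apply: eq_bigr => i _; rewrite liftK.
Qed.

End PrincipalSubspace.

Section LinearRelations.
Variables (K : fieldType) (U V : lmodType K).

Lemma lin_closed_eq (f1 f2 : U -> V) : linear f1 -> linear f2 ->
  lin_closed (fun u => f1 u = f2 u).
Proof.
move=> l1 l2; have [g1 ->] := linear_bundle l1; have [g2 ->] := linear_bundle l2.
by split=> [|c u v Eu Ev]; rewrite ?linear0 // !linearP Eu Ev.
Qed.

Lemma linear_scalel (f : U -> K) (v : V) : scalar f ->
  linear (fun u => f u *: v).
Proof. by move=> lf c u w; rewrite lf scalerDl scalerA. Qed.

End LinearRelations.

(** * The bilinear form on the root lattice and its evenness *)

Section LatticeForm.
Variables (l : nat) (M : 'M[int]_l).
Implicit Types a b : 'rV[int]_l.

Lemma lattice_formDl a a' b :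
  lattice_form M (a + a') b = lattice_form M a b + lattice_form M a' b.
Proof. by rewrite /lattice_form !mulmxDl mxE. Qed.

Lemma lattice_formDr a b b' :
  lattice_form M a (b + b') = lattice_form M a b + lattice_form M a b'.
Proof. by rewrite /lattice_form linearD /= mulmxDr mxE. Qed.

Lemma lattice_formNl a b : lattice_form M (- a) b = - lattice_form M a b.
Proof. by rewrite /lattice_form !mulNmx mxE. Qed.

Lemma lattice_formNr a b : lattice_form M a (- b) = - lattice_form M a b.
Proof. by rewrite /lattice_form linearN /= mulmxN mxE. Qed.

Lemma lattice_form_delta i b :
  lattice_form M (delta_mx 0 i) b = \sum_j M i j * b 0 j.
Proof.
by rewrite /lattice_form -rowE mxE; apply: eq_bigr => j _; rewrite !mxE.
Qed.

Hypothesis M_sym : forall i j, M i j = M j i.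
Hypothesis M_diag : forall i, M i i = 2.

Lemma lattice_form_sym a b : lattice_form M a b = lattice_form M b a.
Proof.
have MT : M^T = M by apply/matrixP => i j; rewrite mxE.
have -> : lattice_form M a b = ((a *m M *m b^T)^T) 0 0 by rewrite mxE.
by rewrite !trmx_mul trmxK MT mulmxA.
Qed.

(** By symmetry, <u + v, u + v> differs from <u, u> + <v, v> by 2 <u, v>, so evenness passes from
    the simple roots to sums. It makes <n, n>/2 an integer. *)
Lemma lattice_form_even a : exists k, lattice_form M a a = k + k.
Proof.
pose E a := exists k, lattice_form M a a = k + k.
have ED u v : E u -> E v -> E (u + v).
  move=> [j jE] [k kE]; exists (j + k + lattice_form M u v).
  rewrite lattice_formDl !lattice_formDr jE kE [lattice_form M v u]lattice_form_sym.
  by lia.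
have EN u : E u -> E (- u).
  by move=> [k kE]; exists k; rewrite lattice_formNl lattice_formNr opprK.
have E0 : E 0 by exists 0; rewrite /lattice_form !mul0mx mxE.
have Edelta i : E (delta_mx 0 i).
  exists 1; rewrite lattice_form_delta (bigD1 i) //= big1 => [|j /negbTE ji].
    by rewrite M_diag mxE !eqxx.
  by rewrite mxE ji andbF mulr0.
have EMn i k : E (delta_mx 0 i *+ k).
  by elim: k => [|k IHk] //; rewrite mulrS; apply: ED.
rewrite -/(E a) (row_sum_delta a); apply: (big_ind E) => // i _.
case: (a 0 i) => k; first by rewrite -natz scaler_nat.
by rewrite NegzE scaleNr -natz scaler_nat; apply: EN.
Qed.

End LatticeForm.

(** * The principal subspace, its character and the recursion *)

Section Character.
Variables (K : fieldType) (l : nat) (g : vectType K).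
Variables (br : g -> g -> g) (form : g -> g -> K) (H : {vspace g}).
Variables (alpha lam : 'I_l -> g) (M : 'M[int]_l).
Variables (s : nat) (eps : 'rV[int]_l -> 'rV[int]_l -> K).
Variables (xr : 'rV[int]_l -> g) (rho : g -> int -> VQ K l -> VQ K l).
Hypothesis charK : [pchar K] =i pred0.
Hypothesis hform : normalized_form br form H.
Hypothesis halpha : simple_roots br form alpha H.
Hypothesis hM : cartan_matrix form alpha M.
Hypothesis hlam : fundamental_weights form alpha H lam.
Hypothesis heps : cocycle M s eps.
Hypothesis hrho : VQ_module br form H alpha M eps xr rho.
Local Notation W := (principal_subspace br form H alpha xr rho).

(** As all roots have square length 2, the Cartan matrix is the Gram matrix of the simple roots. *)
Lemma form_simple i j : form (alpha i) (alpha j) = (M i j)%:~R.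
Proof.
have two_neq0 : 2 != 0 :> K by rewrite ((pcharf0P K).1 charK).
rewrite hM (hform.2 _ (simple_is_root halpha i)).
by rewrite mulrC mulKf.
Qed.

Lemma cartan_sym i j : M i j = M j i.
Proof.
apply: (intr_inj_char0 charK).
by rewrite /= -!form_simple (form_sym hform.1).
Qed.

Lemma cartan_diag i : M i i = 2.
Proof.
apply: (intr_inj_char0 charK); rewrite /= -form_simple.
by rewrite (hform.2 _ (simple_is_root halpha i)).
Qed.

Lemma eps_neq0 a b : eps a b != 0.
Proof.
have [[s_gt0 epsX] _ _ _] := heps.
by apply/eqP => e0; have /eqP := epsX a b; rewrite e0 expr0n gtn_eqF // eq_sym oner_eq0.
Qed.

Lemma of_lattice_delta i : of_lattice alpha (delta_mx 0 i) = alpha i.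
Proof.
rewrite /of_lattice (bigD1 i) //= big1 ?addr0 => [|j /negbTE ji].
  by rewrite mxE !eqxx scale1r.
by rewrite mxE ji andbF scale0r.
Qed.

Lemma positive_simple i : positive_root br form alpha H (delta_mx 0 i).
Proof.
split=> [|j]; first by rewrite of_lattice_delta; apply: (simple_is_root halpha).
by rewrite mxE; case: (_ && _).
Qed.

Lemma form_lattice x b :
  form x (of_lattice alpha b) = \sum_j (b 0 j)%:~R * form x (alpha j).
Proof.
have lf : linear (form x : g -> K^o).
  by move=> c y z; rewrite !(form_sym hform.1 x); apply: (form_linearl hform.1).
have [f fE] := linear_bundle lf; rewrite -[LHS]/((form x : g -> K^o) _) fE.
by rewrite linear_sum; apply: eq_bigr => j _; rewrite linearZ /= -fE.
Qed.

(** Both sides are linear in h and the simple roots span H, so the prescribed action of alpha_j(0)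
    decides. *)
Lemma rho_cartan h b m : h \in H ->
  rho h 0 (vec b (mono K m)) =
  form h (of_lattice alpha b) *: vec b (mono K m).
Proof.
have /andP[/eqP hH _] := simple_basis halpha.
rewrite -hH => /(@coord_span _ _ _ (in_tuple _)) ->.
have closed : lin_closed (fun y => rho y 0 (vec b (mono K m)) =
    form y (of_lattice alpha b) *: vec b (mono K m)).
  apply: lin_closed_eq; first exact: rho_linear_arg hrho _ _.
  by apply: linear_scalel; apply: form_linearl hform.1 _.
apply: (lin_closed_sum _ closed) => i _; apply: (lin_closedZ _ closed).
have /mapP[j _ ->] : (in_tuple [seq alpha i | i <- enum 'I_l])`_i \in
    [seq alpha i | i <- enum 'I_l] by apply: mem_nth.
suff -> : form (alpha j) (of_lattice alpha b) =
    (lattice_form M (delta_mx 0 j) b)%:~R.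
  exact: etrans (rho_heis hrho _ _ _) (heis0 _ _ _ _).
rewrite lattice_form_delta form_lattice rmorph_sum; apply: eq_bigr => k _.
by rewrite form_simple rmorphM mulrC.
Qed.

Lemma rho_weight j w :
  rho (lam j) 0 w = diag (fun u : VQbasis l => (u.2 0 j)%:~R) w.
Proof.
have [lamH lamE] := hlam j.
move: w; apply: eq_linear_VQ => [||b m].
- exact: rho_linear hrho _ _.
- exact: lin_ext_is_linear.
rewrite rho_cartan // form_lattice (bigD1 j) //= big1 => [|k /negbTE kj].
  by rewrite lamE eqxx mulr1 addr0 vecE /diag lin_extE.
by rewrite lamE eq_sym kj mulr0.
Qed.

(** Positive roots have nonnegative coordinates, so their vertex operators preserve the explicit
    span; conversely, the simple root operators already reach all of it. *)
Lemma principal_subspaceP v : W v <-> principal charK v.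
Proof.
rewrite /principal_subspace lin_spanE.
set G := (X in span_of X v <-> _); split.
  move=> sv; apply: (span_sub sv); first exact: principal_lin_closed.
  move=> _ [t tn ->] {v sv}; elim: t tn => [|[y n] t IHt] tn.
    exact: principal_vacuum.
  have /IHt /= {IHt} : forall ym, ym \in t -> nilradical br form H alpha xr ym.1.
    by move=> ym yt; apply: tn; rewrite inE yt orbT.
  set w := foldr _ _ _ => Pw.
  have := tn _ (mem_head _ _); rewrite /nilradical lin_spanE /= => sy.
  apply: (span_sub sy (S := fun y => principal charK (rho y n w))).
    apply: (@lin_closed_preim _ _ _ (fun y => rho y n w) (principal charK)).
      exact: rho_linear_arg hrho n w.
    exact: principal_lin_closed.
  move=> _ [b [b_root b_ge0] <-]; rewrite (rho_vertex hrho) //.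
  exact: principal_vertex.
apply: (principal_sub (M := M) (W := span_of G) eps_neq0).
- exact: span_lin_closed.
- by apply: span_gen; exists [::].
move=> i n w Gw; have [root_i _] := positive_simple i.
rewrite -(rho_vertex hrho) //.
apply: (span_sub Gw (S := fun w => span_of G (rho (xr (delta_mx 0 i)) n w))).
  apply: (@lin_closed_preim _ _ _ (rho (xr (delta_mx 0 i)) n) (span_of G)).
    exact: rho_linear hrho _ n.
  exact: span_lin_closed.
move=> _ [t tn ->]; apply: span_gen; exists ((xr (delta_mx 0 i), n) :: t) => //.
move=> ym; rewrite inE => /orP[/eqP->|/tn//] /=.
rewrite /nilradical lin_spanE; apply: span_gen.
by exists (delta_mx 0 i) => //; apply: positive_simple.
Qed.

(** Turns coefficients of the character into cardinalities, which reduces the recursion to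
    [enumerates_slice]. *)
Lemma characterE n d k t : lattice_form M n n = k + k ->
  enumerates t (slice n (d - k)) -> character M lam rho W (n, d) = (size t)%:R.
Proof.
move=> nk tE; rewrite /character; congr (_%:R); apply: dimensionE.
have := weight_has_dim charK nk tE; congr has_dim; apply/seteqP; split=> w /=.
  move=> [Pw wn wd]; split; [exact/principal_subspaceP| |exact: wd].
  by move=> j; apply: etrans (rho_weight j w) (wn j).
move=> [Ww wn wd]; split; [exact/principal_subspaceP| |exact: wd].
by move=> j; apply: etrans (esym (rho_weight j w)) (wn j).
Qed.

Lemma character_recursion i :
  let chi := character M lam rho W in
  chi = qshift (delta_mx 0 i) chi
        \+ monomial_mul (delta_mx 0 i, 1) (qshift (row i M) chi).
Proof.
move=> chi; apply/funext => -[n d]; rewrite /chi /= /monomial_mul /qshift /=.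
have [k nk] := lattice_form_even cartan_sym cartan_diag n.
have [t1 t1E] := enumerates_ex (n - delta_mx 0 i) (d - k).
have [t2 t2E] := enumerates_ex n (d - k - n 0 i).
have formE : \sum_j M i j * n 0 j = lattice_form M (delta_mx 0 i) n.
  by rewrite lattice_form_delta.
have delta2 : lattice_form M (delta_mx 0 i) (delta_mx 0 i) = 2.
  rewrite lattice_form_delta (bigD1 i) //= big1 ?addr0 => [|j /negbTE ji].
    by rewrite cartan_diag mxE !eqxx mulr1.
  by rewrite mxE ji andbF mulr0.
(* The list t2 counts the term with x_i replaced by x_i q, and t1 the term with factor x_i q; hence
   the exchange of summands. *)
rewrite (characterE nk (enumerates_slice t1E t2E)) size_cat size_map addnC natrD.
congr (_ + _).
  have -> : \sum_j (delta_mx 0 i : 'rV[int]_l) 0 j * n 0 j = n 0 i.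
    rewrite (bigD1 i) //= big1 ?addr0 => [|j /negbTE ji].
      by rewrite mxE !eqxx mul1r.
    by rewrite mxE ji andbF mul0r.
  by rewrite (@characterE _ _ k t2) // addrAC.
have -> : \sum_j row i M 0 j * (n - delta_mx 0 i) 0 j =
    lattice_form M (delta_mx 0 i) n - 2.
  transitivity (lattice_form M (delta_mx 0 i) (n - delta_mx 0 i)).
    by rewrite lattice_form_delta; apply: eq_bigr => j _; rewrite [row i M 0 j]mxE.
  by rewrite lattice_formDr lattice_formNr delta2.
(* Half of <n - alpha_i, n - alpha_i> is k - <alpha_i, n> + 1, and the q-shifts of the second term
   leave exactly d - k for the partitions. *)
rewrite (@characterE _ _ (k - lattice_form M (delta_mx 0 i) n + 1) t1) //.
  rewrite lattice_formDl !lattice_formDr !lattice_formNl !lattice_formNr nk delta2.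
  rewrite (lattice_form_sym cartan_sym n); lia.
by rewrite (_ : _ - _ = d - k) //; lia.
Qed.

End Character.

Theorem theorem5p3 (R : realType) (l : nat) (g : vectType R[i])
    (br : g -> g -> g) (form : g -> g -> R[i]) (H : {vspace g})
    (alpha lam : 'I_l -> g) (M : 'M[int]_l)
    (s : nat) (eps : 'rV[int]_l -> 'rV[int]_l -> R[i])
    (xr : 'rV[int]_l -> g) (rho : g -> int -> VQ R[i] l -> VQ R[i] l)
    (hg : simple_lie_algebra br)
    (hH : cartan_subalgebra br H)
    (hform : normalized_form br form H)
    (halpha : simple_roots br form alpha H)
    (hM : cartan_matrix form alpha M)
    (hADE : type_ADE M)
    (hlam : fundamental_weights form alpha H lam)
    (heps : cocycle M s eps)
    (hrho : VQ_module br form H alpha M eps xr rho)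
    (i : 'I_l) :
  let chi := character M lam rho
    (principal_subspace br form H alpha xr rho) in
  chi = qshift (delta_mx 0 i) chi
        \+ monomial_mul (delta_mx 0 i, 1) (qshift (row i M) chi).
Proof.
exact: (character_recursion (pchar_num _) hform halpha hM hlam heps hrho i).
Qed.
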